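(* Under the $k$-Cycle Hypothesis, for any constant $\varepsilon>0$, no $O(m^{2-\varepsilon})$-time algorithm can provide any finite approximation for $n$-Pairs Minimum Distance in directed (unweighted) graphs with $m$ edges.
   Context: $n$-Pairs Minimum Distance: given a graph with $n$ vertices and $O(n)$ vertex pairs $(s_i,t_i)$, compute $\min_i d(s_i,t_i)$, where $d(s,t)$ is the directed distance ($\infty$ if $t$ is unreachable from $s$). A finite approximation with ratio $\alpha<\infty$ means an output $\hat x$ with $x\le\hat x\le\alpha x$ (in particular, it distinguishes finite from infinite values). $k$-Cycle Hypothesis: in the word-RAM model with $O(\log n)$-bit words, for any constant $\varepsilon>0$ there exists a constant integer $k$ such that there is no $O(m^{2-\varepsilon})$-time algorithm for detecting a $k$-cycle in $m$-edge directed graphs. *)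

(* Defs.v *)
(* MathComp / MathComp-Analysis *)
From HB Require Import structures.
From mathcomp Require Import all_boot all_order all_algebra.
From mathcomp Require Import all_classical all_reals all_analysis.
Set Implicit Arguments.
Unset Strict Implicit.
Unset Printing Implicit Defensive.
Import Order.TTheory GRing.Theory Num.Theory.

(** * The word RAM with [w]-bit words

    A program is a finite list of instructions working
    on registers and on a random-access memory, all holding words, i.e.
    numbers below [2 ^ w].  Every instruction costs one time unit. *)

Inductive binop :=
  | Oadd | Osub | Omul | Odiv | Omod | Oand | Oor | Oxor | Oshl | Oshr | Olt | Oeq.

Inductive instr :=
  | Const of nat & nat             (* Const r a     : r := a            *)
  | Op of binop & nat & nat & nat  (* Op o r r1 r2  : r := r1 o r2      *)
  | Read of nat & nat              (* Read r r1     : r := mem[r1]      *)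
  | Write of nat & nat             (* Write r1 r2   : mem[r1] := r2     *)
  | Jz of nat & nat                (* Jz r l        : if r = 0 goto l   *)
  | Halt.

Definition program := seq instr.

Record state := State { pc : nat; regs : nat -> nat; memory : nat -> nat }.

(* Arithmetic is modulo [2 ^ w]; division and remainder by zero follow
   [divn] and [modn]. *)
Definition eval_op (w : nat) (o : binop) (a b : nat) : nat :=
  (match o with
   | Oadd => a + b
   | Osub => a + (2 ^ w - b)
   | Omul => a * b
   | Odiv => a %/ b
   | Omod => a %% b
   | Oand => Nat.land a b
   | Oor  => Nat.lor a b
   | Oxor => Nat.lxor a b
   | Oshl => a * 2 ^ b
   | Oshr => a %/ 2 ^ b
   | Olt  => nat_of_bool (a < b)
   | Oeq  => nat_of_bool (a == b)
   end) %% 2 ^ w.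

(* Leaving the program halts the machine. *)
Definition fetch (P : program) (s : state) : instr := nth Halt P (pc s).

(* A halted state is a fixed point of [step]. *)
Definition step (w : nat) (P : program) (s : state) : state :=
  let: State i f g := s in
  match fetch P s with
  | Const r a    => State i.+1 [eta f with r |-> a %% 2 ^ w] g
  | Op o r r1 r2 => State i.+1 [eta f with r |-> eval_op w o (f r1) (f r2)] g
  | Read r r1    => State i.+1 [eta f with r |-> g (f r1)] g
  | Write r1 r2  => State i.+1 f [eta g with f r1 |-> f r2]
  | Jz r l       => State (if f r == 0 then l else i.+1) f g
  | Halt         => s
  end.

Definition halted (P : program) (s : state) : bool :=
  if fetch P s is Halt then true else false.

(* The input occupies the first memory cells; everything else is zero. *)
Definition init (w : nat) (input : seq nat) : state :=
  State 0 (fun=> 0) (fun a => nth 0 input a %% 2 ^ w).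

(* Since halted states are fixed points, [halted P (run w P input t)] says that
   the running time on [input] is at most [t]. *)
Definition run (w : nat) (P : program) (input : seq nat) (t : nat) : state :=
  iter t (step w P) (init w input).

(* [O(log n)]-bit words; the factor [c] is a constant of the algorithm. *)
Definition word_size (c n : nat) : nat := c * (trunc_log 2 n).+1.

(** * Directed graphs *)

(* The arcs come in an arbitrary order, since the list is also the input given
   to the algorithms. *)
Record digraph := Digraph {
  nverts : nat;
  arcs : seq ('I_nverts * 'I_nverts);
  arcs_uniq : uniq arcs;
  arcs_loopless : all (fun a => a.1 != a.2) arcs
}.

Definition narcs (G : digraph) : nat := size (arcs G).

Definition adj (G : digraph) : rel 'I_(nverts G) :=
  fun u v => (u, v) \in arcs G.

Definition encode_pairs (n : nat) (s : seq ('I_n * 'I_n)) : seq nat :=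
  size s :: flatten [seq [:: val x.1; val x.2] | x <- s].

Definition encode_digraph (G : digraph) : seq nat :=
  nverts G :: encode_pairs (arcs G).

(** * Detection of [k]-cycles *)

Definition has_kcycle (k : nat) (G : digraph) : bool :=
  [exists c : k.-tuple 'I_(nverts G), ucycleb (@adj G) c].

Local Open Scope ring_scope.

(* [P] answers through register 0 (nonzero for yes).  The guard [0 < m] only
   discards the meaningless bound [0] on the time spent on arcless graphs. *)
Definition detects_kcycle (R : realType) (k : nat) (P : program) (c : nat)
    (C e : R) : Prop :=
  forall G : digraph, exists t : nat,
    let s := run (word_size c (nverts G)) P (encode_digraph G) t in
    [/\ halted P s,
        (regs s 0 != 0)%N = has_kcycle k G
      & (0 < narcs G)%N -> t%:R <= C * (narcs G)%:R `^ e].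

Definition kCycle_Hypothesis (R : realType) : Prop :=
  forall eps : R, 0 < eps ->
  exists2 k : nat, (0 < k)%N &
    ~ exists (P : program) (c : nat) (C : R),
        detects_kcycle k P c C (2 - eps).

(** * [n]-Pairs Minimum Distance *)

Local Open Scope ereal_scope.
Local Open Scope classical_set_scope.

(* The infimum of the lengths of the walks from [s] to [t]; [+oo] if there is
   none.  In a nonempty walk [s :: p], [size p] is the number of arcs. *)
Definition dist (R : realType) (G : digraph) (s t : 'I_(nverts G)) : \bar R :=
  ereal_inf [set (size p)%:R%:E | p in
    [set p : seq 'I_(nverts G) | path (@adj G) s p /\ last s p = t]].

Definition min_dist (R : realType) (G : digraph)
    (pairs : seq ('I_(nverts G) * 'I_(nverts G))) : \bar R :=
  \big[mine/+oo]_(x <- pairs) dist R x.1 x.2.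

(* Register 0 tells whether the output is finite, register 1 is its value. *)
Definition output (R : realType) (s : state) : \bar R :=
  if regs s 0 == 0%N then +oo else (regs s 1)%:R%:E.

(* The instances have [n <= m + 1] vertices and at most [K * n] pairs.  Without
   the former, no bound in terms of [m] alone could hold, merely because the
   list of pairs could be much longer than [m].  The ratio [alpha n m] may
   depend on the size of the graph. *)
Definition approximates_min_dist (R : realType) (K : nat)
    (alpha : nat -> nat -> R) (P : program) (c : nat) (C e : R) : Prop :=
  forall (G : digraph) (pairs : seq ('I_(nverts G) * 'I_(nverts G))),
    (nverts G <= (narcs G).+1)%N -> (size pairs <= K * nverts G)%N ->
  exists t : nat,
    let s := run (word_size c (nverts G)) P
                 (encode_digraph G ++ encode_pairs pairs) t in
    let x := min_dist R pairs in
    [/\ halted P s,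
        x <= output R s <= (alpha (nverts G) (narcs G))%:E * x
      & (0 < narcs G)%N -> (t%:R <= C * (narcs G)%:R `^ e)%R].

(* Main.v *)
(** A [k]-cycle is found by colour coding.  Colour [k] classes of vertices
    deterministically: for every ordered pair of colours guess one bit of the
    (renamed) vertex numbers, or its complement, that is 0 on the first colour
    and 1 on the second.  There are only polylogarithmically many guesses, the
    colour classes of a guess are disjoint, and every [k]-cycle is properly
    coloured by some guess.  For each guess, the layered graph with [k + 1]
    copies of the vertices, in which the arcs lead from colour [i] in layer [i]
    to colour [i + 1] in layer [i + 1], has a path from the copy of some vertex
    in the first layer to its copy in the last one iff the graph has a properly
    coloured [k]-cycle; so a finite approximation of the minimum distance over
    these pairs decides it.  The polylogarithmic factor is absorbed by halving
    [eps].

    The reduction runs on the word RAM itself.  Vertices are first renamed by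
    positions in the arc list, so that the running time depends on the number
    of arcs only, and every call of the approximation algorithm is simulated,
    on its own shorter words, in a block of memory not used before, hence still
    zero. *)
Require Import Defs.
From mathcomp Require Import all_boot all_order all_algebra.
From mathcomp Require Import all_classical all_reals all_analysis.
From mathcomp Require Import zify lra.
Import Order.TTheory GRing.Theory Num.Theory.
Set Implicit Arguments.
Unset Strict Implicit.
Unset Printing Implicit Defensive.


(** The time allowed depends on the number [m] of arcs, while isolated vertices can make the number
    [n] of vertices far larger. So no loop of the detector runs over old vertex numbers: they only
    serve as addresses into a table that is never cleared, of which only entries already written are
    read.

    All instances built from one graph have equally many vertices and equally many arcs, since an
    arc that breaks the colouring is redirected rather than dropped. Hence one simulated word size,
    one block length and one time bound serve every colouring. The arcs into the sink supply the
    bound on vertices by arcs that the approximation algorithm demands; they create no walk between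
    layers, because no arc leaves the sink.

    Of each output only its finiteness is read, which is why an arbitrary function [alpha] can be
    allowed as the ratio. *)

(** * Placement of code fragments and execution steps *)

Definition contains (Q : program) (off : nat) (s : seq instr) : Prop :=
  forall i, i < size s -> nth Halt Q (off + i) = nth Halt s i.

Lemma contains_cat Q off s1 s2 : contains Q off (s1 ++ s2) ->
  contains Q off s1 /\ contains Q (off + size s1) s2.
Proof.
move=> H; split=> i Hi.
  by rewrite H ?nth_cat ?Hi // size_cat ltn_addr.
rewrite -addnA H ?size_cat ?ltn_add2l // nth_cat ltnNge leq_addr /=.
by rewrite addKn.
Qed.

Lemma contains_cons Q off a s : contains Q off (a :: s) ->
  nth Halt Q off = a /\ contains Q off.+1 s.
Proof.
move=> H; split; first by rewrite -[off]addn0 H.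
by move=> i Hi; rewrite addSnnS H.
Qed.

Lemma contains_self s : contains s 0 s.
Proof. by []. Qed.

Definition steps w Q t s s' : Prop := iter t (step w Q) s = s'.

Lemma steps_trans w Q t1 t2 s1 s2 s3 :
  steps w Q t1 s1 s2 -> steps w Q t2 s2 s3 -> steps w Q (t1 + t2) s1 s3.
Proof. by move=> <- <-; rewrite /steps addnC iterD. Qed.

Lemma steps_cons w Q t s1 s2 s3 :
  steps w Q 1 s1 s2 -> steps w Q t s2 s3 -> steps w Q t.+1 s1 s3.
Proof. by rewrite -add1n; apply: steps_trans. Qed.

Lemma steps1 w Q i f g ins s : nth Halt Q i = ins ->
  match ins with
  | Const r a    => State i.+1 [eta f with r |-> a %% 2 ^ w] g
  | Op o r r1 r2 => State i.+1 [eta f with r |-> eval_op w o (f r1) (f r2)] g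
  | Read r r1    => State i.+1 [eta f with r |-> g (f r1)] g
  | Write r1 r2  => State i.+1 f [eta g with f r1 |-> f r2]
  | Jz r l       => State (if f r == 0 then l else i.+1) f g
  | Halt         => State i f g
  end = s -> steps w Q 1 (State i f g) s.
Proof. by move=> H <-; rewrite /steps /= /fetch /= H; case: (ins). Qed.

Lemma pow2_gt0 w : 0 < 2 ^ w.
Proof. by rewrite expn_gt0. Qed.

Lemma eval_op_lt w o a b : eval_op w o a b < 2 ^ w.
Proof. by rewrite /eval_op ltn_mod pow2_gt0. Qed.

(** * A small imperative language *)

Inductive expr :=
  | EV of nat
  | EC of nat
  | EO of binop & expr & expr
  | EL of expr.

(* [Sim P vb vw v0] runs [P] with its register [r] kept in variable [v0 + r],
   on words reduced modulo the value of variable [vw], its memory starting at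
   the address stored in variable [vb]. *)
Inductive cmd :=
  | Skip
  | Asg of nat & expr
  | Store of expr & expr
  | Seq of cmd & cmd
  | For of nat & nat & cmd
  | Sim of program & nat & nat & nat.

Definition upd (v : nat -> nat) (r a : nat) : nat -> nat :=
  [eta v with r |-> a].

Fixpoint eval_expr w (v g : nat -> nat) e : nat :=
  match e with
  | EV r => v r
  | EC a => a %% 2 ^ w
  | EO o e1 e2 => eval_op w o (eval_expr w v g e1) (eval_expr w v g e2)
  | EL e => g (eval_expr w v g e)
  end.

(* Variable [r] lives in register [2 r]; the odd registers hold temporaries. *)
Fixpoint cexpr d e : seq instr :=
  match e with
  | EV r => [:: Op Oor d.*2.+1 r.*2 r.*2]
  | EC a => [:: Const d.*2.+1 a]
  | EO o e1 e2 =>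
      cexpr d e1 ++ cexpr d.+1 e2 ++ [:: Op o d.*2.+1 d.*2.+1 d.+1.*2.+1]
  | EL e => cexpr d e ++ [:: Read d.*2.+1 d.*2.+1]
  end.

(** Every simulated instruction takes exactly two machine instructions, so addresses of jump targets
    are obtained by doubling; [Const 1 0] on the temporary register 1 is mere padding after a jump.
    Targets beyond the program are clipped to its end, where the simulated machine counts as
    halted. *)
Definition csim (vb vw v0 off lend : nat) (n : nat) (i : instr) : seq instr :=
  let x r := (v0 + r).*2 in
  match i with
  | Const r a => [:: Const (x r) a; Op Omod (x r) (x r) vw.*2]
  | Op o r r1 r2 => [:: Op o (x r) (x r1) (x r2); Op Omod (x r) (x r) vw.*2]
  | Read r r1 => [:: Op Oadd 1 vb.*2 (x r1); Read (x r) 1]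
  | Write r1 r2 => [:: Op Oadd 1 vb.*2 (x r1); Write 1 (x r2)]
  | Jz r l => [:: Jz (x r) (off + (minn l n).*2); Const 1 0]
  | Halt => [:: Const 1 0; Jz 1 lend]
  end.

(** The length does not depend on the offset, so the exit address of a loop is known before its body
    is compiled. *)
Fixpoint csize c : nat :=
  match c with
  | Skip => 0
  | Asg r e => size (cexpr 0 e) + 1
  | Store e1 e2 => size (cexpr 0 e1) + (size (cexpr 1 e2) + 1)
  | Seq c1 c2 => csize c1 + csize c2
  | For r lim c => csize c + 7
  | Sim P vb vw v0 => (size P).*2
  end.

Fixpoint compile off c : seq instr :=
  match c with
  | Skip => [::]
  | Asg r e => cexpr 0 e ++ [:: Op Oor r.*2 1 1]
  | Store e1 e2 => cexpr 0 e1 ++ cexpr 1 e2 ++ [:: Write 1 3]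
  | Seq c1 c2 => compile off c1 ++ compile (off + csize c1) c2
  | For r lim c =>
      [:: Const r.*2 0; Op Olt 1 r.*2 lim.*2; Jz 1 (off + (csize c + 7))] ++
      compile (off + 3) c ++
      [:: Const 1 1; Op Oadd r.*2 r.*2 1; Const 1 0; Jz 1 off.+1]
  | Sim P vb vw v0 =>
      flatten [seq csim vb vw v0 off (off + (size P).*2) (size P) i | i <- P]
  end.

Lemma size_flatten2 (T U : Type) (f : T -> seq U) s :
  (forall x, size (f x) = 2) -> size (flatten (map f s)) = (size s).*2.
Proof.
by move=> H; elim: s => //= x s IH; rewrite size_cat H IH doubleS.
Qed.

Lemma nth_flatten2 (T U : Type) (u0 : U) (t0 : T) (f : T -> seq U) s i j :
  (forall x, size (f x) = 2) -> i < size s -> j < 2 ->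
  nth u0 (flatten (map f s)) (i.*2 + j) = nth u0 (f (nth t0 s i)) j.
Proof.
move=> H; elim: s i => //= x s IH [|i] Hi Hj.
  by rewrite nth_cat H Hj.
rewrite nth_cat H doubleS !addSn /= -IH //.
by rewrite subSS subSS subn0.
Qed.

Lemma size_csim vb vw v0 off lend n i : size (csim vb vw v0 off lend n i) = 2.
Proof. by case: i. Qed.

Lemma size_compile off c : size (compile off c) = csize c.
Proof.
elim: c off => //=.
- by move=> r e off; rewrite size_cat.
- by move=> e1 e2 off; rewrite !size_cat.
- by move=> c1 IH1 c2 IH2 off; rewrite size_cat IH1 IH2.
- by move=> r l c IH off; rewrite size_cat IH /=; lia.
- by move=> P vb vw v0 off; rewrite size_flatten2 // => i; exact: size_csim.
Qed.

(** * A Hoare logic with time bounds *)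

Definition vstate := (nat -> nat) -> (nat -> nat) -> Prop.

(** The odd registers are left arbitrary. The bounds make a copy by [Oor r r] exact, since [eval_op]
    reduces modulo [2 ^ w]. *)
Definition represents w (v g f : nat -> nat) : Prop :=
  [/\ forall r, f r.*2 = v r, forall r, v r < 2 ^ w & forall a, g a < 2 ^ w].

(** Total correctness within [T] steps, for any placement of the code inside any program; this is
    what makes the rules compositional. *)
Definition triple w (pre : vstate) c (post : vstate) (T : nat) : Prop :=
  forall Q off v g f, contains Q off (compile off c) -> represents w v g f ->
  pre v g ->
  exists t v' g' f',
    [/\ t <= T,
        steps w Q t (State off f g) (State (off + csize c) f' g'),
        represents w v' g' f' & post v' g'].

Lemma eq_double r r' : (r.*2 == r'.*2) = (r == r').
Proof. by apply/eqP/eqP; lia. Qed.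

Lemma eq_doubleS r r' : (r.*2 == r'.*2.+1) = false.
Proof. by apply/eqP; lia. Qed.

Lemma eq_doubleSS r r' : (r.*2.+1 == r'.*2.+1) = (r == r').
Proof. exact: eq_double. Qed.

Lemma eq_double1 r : (r.*2 == 1) = false.
Proof. by apply/eqP; lia. Qed.

(** The last clause keeps the induction going: the left operand, stored at depth [d], survives the
    evaluation of the right one at depth [d.+1]. *)
Lemma cexpr_steps w e d Q off v g f : contains Q off (cexpr d e) ->
  represents w v g f ->
  exists f', [/\ steps w Q (size (cexpr d e)) (State off f g)
                   (State (off + size (cexpr d e)) f' g),
     represents w v g f', f' d.*2.+1 = eval_expr w v g e &
     forall d', d' < d -> f' d'.*2.+1 = f d'.*2.+1].
Proof.
elim: e d off f => [r|a|o e1 IH1 e2 IH2|e IH] d off f /= HQ [Hf Hv Hg].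
- have [H _] := contains_cons HQ.
  eexists; split.
  + by rewrite addn1; apply: (steps1 H); reflexivity.
  + by split=> //= r'; rewrite eq_doubleS Hf.
  + by rewrite /= eqxx Hf /eval_op PeanoNat.Nat.lor_diag modn_small.
  + by move=> d' Hd; rewrite /= eq_doubleSS ltn_eqF.
- have [H _] := contains_cons HQ.
  eexists; split.
  + by rewrite addn1; apply: (steps1 H); reflexivity.
  + by split=> //= r'; rewrite eq_doubleS Hf.
  + by rewrite /= eqxx.
  + by move=> d' Hd; rewrite /= eq_doubleSS ltn_eqF.
- have [HQ1 /contains_cat [HQ2 HQ3]] := contains_cat HQ.
  have [f1 [S1 R1 V1 T1]] := IH1 d off f HQ1 (And3 Hf Hv Hg).
  have [f2 [S2 R2 V2 T2]] := IH2 d.+1 _ f1 HQ2 R1.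
  have [H _] := contains_cons HQ3.
  eexists; split.
  + rewrite !size_cat /= !addnA.
    apply: (@steps_trans _ _ _ 1 _ (State (off + size (cexpr d e1) + size (cexpr d.+1 e2)) f2 g)).
      exact: steps_trans S1 S2.
    by rewrite addn1; apply: (steps1 H); reflexivity.
  + by case: R2 => Hf2 _ _; split=> //= r'; rewrite eq_doubleS Hf2.
  + by rewrite /= eqxx V2 T2 // V1.
  + by move=> d' Hd; rewrite /= eq_doubleSS ltn_eqF // T2 ?(leqW Hd) // T1.
- have [HQ1 HQ2] := contains_cat HQ.
  have [f1 [S1 R1 V1 T1]] := IH d off f HQ1 (And3 Hf Hv Hg).
  have [H _] := contains_cons HQ2.
  eexists; split.
  + rewrite !size_cat /=.
    apply: (steps_trans S1).
    by rewrite !addnA [_ + _ + 1]addn1; apply: (steps1 H); reflexivity.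
  + by case: R1 => Hf2 _ _; split=> //= r'; rewrite eq_doubleS Hf2.
  + by rewrite /= eqxx V1.
  + by move=> d' Hd; rewrite /= eq_doubleSS ltn_eqF // T1.
Qed.

Lemma eval_lt w v g e : (forall r, v r < 2 ^ w) -> (forall a, g a < 2 ^ w) ->
  eval_expr w v g e < 2 ^ w.
Proof.
move=> Hv Hg; case: e => //= [a|o e1 e2]; last exact: eval_op_lt.
by rewrite ltn_mod pow2_gt0.
Qed.

Lemma triple_skip w (P : vstate) : triple w P Skip P 0.
Proof.
move=> Q off v g f _ R HP; exists 0, v, g, f; split=> //=.
by rewrite addn0.
Qed.

Lemma triple_asg w (post : vstate) r e :
  triple w (fun v g => post (upd v r (eval_expr w v g e)) g) (Asg r e) post
    (csize (Asg r e)).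
Proof.
move=> Q off v g f /= HQ R HP.
have [HQ1 HQ2] := contains_cat HQ.
have [f1 [S1 R1 V1 _]] := cexpr_steps HQ1 R.
have [H _] := contains_cons HQ2.
do 4 eexists; split; [exact: leqnn | | | exact: HP].
  apply: (steps_trans S1).
  by rewrite !addnA addn1; apply: (steps1 H); reflexivity.
case: R1 => Hf1 Hv Hg; split=> // r'; rewrite /upd /=.
  rewrite eq_double.
  case: eqP => // _.
  by rewrite V1 /eval_op PeanoNat.Nat.lor_diag modn_small // eval_lt.
by case: eqP => // _; rewrite eval_lt.
Qed.

Lemma triple_store w (post : vstate) e1 e2 :
  triple w (fun v g => post v (upd g (eval_expr w v g e1) (eval_expr w v g e2)))
    (Store e1 e2) post (csize (Store e1 e2)).
Proof.
move=> Q off v g f /= HQ R HP.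
have [HQ1 /contains_cat [HQ2 HQ3]] := contains_cat HQ.
have [f1 [S1 R1 V1 _]] := cexpr_steps HQ1 R.
have [f2 [S2 R2 V2 T2]] := cexpr_steps HQ2 R1.
have [H _] := contains_cons HQ3.
do 4 eexists; split; [exact: leqnn | | | exact: HP].
  apply: (steps_trans S1); apply: (steps_trans S2).
  rewrite !addnA addn1; apply: (steps1 H).
  by rewrite V2 (T2 0) // V1; reflexivity.
case: R2 => Hf Hv Hg; split=> // a; rewrite /upd /=.
by case: eqP => // _; rewrite eval_lt.
Qed.

Lemma triple_seq w (P1 P2 P3 : vstate) c1 c2 T1 T2 :
  triple w P1 c1 P2 T1 -> triple w P2 c2 P3 T2 ->
  triple w P1 (Seq c1 c2) P3 (T1 + T2).
Proof.
move=> H1 H2 Q off v g f /= HQ R HP.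
have [HQ1 HQ2] := contains_cat HQ.
have [t1 [v1 [g1 [f1 [L1 S1 R1 X1]]]]] := H1 _ _ _ _ _ HQ1 R HP.
rewrite size_compile in HQ2.
have [t2 [v2 [g2 [f2 [L2 S2 R2 X2]]]]] := H2 _ _ _ _ _ HQ2 R1 X1.
exists (t1 + t2), v2, g2, f2; split=> //; first exact: leq_add.
by rewrite addnA; apply: steps_trans S1 S2.
Qed.

Lemma triple_conseq w (P1 P1' P2 P2' : vstate) c T T' :
  triple w P1 c P2 T -> (forall v g, P1' v g -> P1 v g) ->
  (forall v g, P2 v g -> P2' v g) -> T <= T' -> triple w P1' c P2' T'.
Proof.
move=> H H1 H2 HT Q off v g f HQ R HP.
have [t [v1 [g1 [f1 [L1 S1 R1 X1]]]]] := H _ _ _ _ _ HQ R (H1 _ _ HP).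
exists t, v1, g1, f1; split=> //; first exact: leq_trans HT.
exact: H2.
Qed.

Lemma triple_bounded w (P P' : vstate) c T :
  triple w (fun v g => [/\ P v g, forall r, v r < 2 ^ w & forall a, g a < 2 ^ w])
    c P' T -> triple w P c P' T.
Proof.
move=> H Q off v g f HQ R HP; apply: (H _ _ _ _ _ HQ (R)).
by case: R.
Qed.

Lemma triple_assume w (A : Prop) (P P' : vstate) c T :
  (A -> triple w P c P' T) -> (forall v g, P v g -> A) -> triple w P c P' T.
Proof. by move=> H HA Q off v g f HQ R HP; exact: (H (HA _ _ HP) _ _ _ _ _ HQ R HP). Qed.

(** A round costs its body, two steps of test and four of increment and jump back; the 3 is the
    initialisation and the failing test. The counter cannot overflow, because the limit is itself a
    stored word. *)
Lemma triple_for w (I : nat -> vstate) r lim n c T : r != lim ->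
  (forall i, i < n ->
     triple w (fun v g => [/\ I i v g, v r = i & v lim = n]) c
       (fun v g => [/\ I i.+1 (upd v r i.+1) g, v r = i & v lim = n]) T) ->
  triple w (fun v g => I 0 (upd v r 0) g /\ v lim = n) (For r lim c)
    (fun v g => I n v g /\ v lim = n) (n * (T + 6) + 3).
Proof.
move=> Nrl Hc Q off v g f /= HQ R [HI Hl].
have [H0 HQ1] := contains_cons HQ.
have [H1 HQ2] := contains_cons HQ1.
have [H2 HQ3] := contains_cons HQ2.
have [HQ4 HQ5] := contains_cat HQ3.
have [H5 HQ6] := contains_cons HQ5.
have [H6 HQ7] := contains_cons HQ6.
have [H7 HQ8] := contains_cons HQ7.
have [H8 _] := contains_cons HQ8.
have n_lt : n < 2 ^ w by rewrite -Hl; case: R.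
(* Induction on the number [j] of rounds left, entered at the test rather than at the
   initialisation. *)
suff loop : forall j i v g f, j + i = n -> represents w v g f -> I i v g ->
    v r = i -> v lim = n ->
    exists t v' g' f', [/\ t <= j * (T + 6) + 2,
      steps w Q t (State off.+1 f g) (State (off + (csize c + 7)) f' g'),
      represents w v' g' f' & I n v' g' /\ v' lim = n].
  have [|||t [v' [g' [f' [Ht S' R' I']]]]] :=
    loop n 0 (upd v r 0) g [eta f with r.*2 |-> 0 %% 2 ^ w] (addn0 n) _ HI.
  - case: R => Rf Rv Rg; split=> // x; rewrite /upd /=.
      by rewrite eq_double mod0n; case: eqP.
    by case: eqP => // _; rewrite pow2_gt0.
  - by rewrite /upd /= eqxx.
  - by rewrite /upd /= eq_sym (negbTE Nrl).
  exists (1 + t), v', g', f'; split=> //; first lia.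
  by apply: steps_trans S'; apply: (steps1 H0).
elim=> [|j IH] i {}v {}g {}f Hi {}R {}HI Hr {}Hl.
  exists 2, v, g, [eta f with 1 |-> 0]; split=> //; last first.
  - by move: Hi HI; rewrite add0n => ->.
  - by case: R => Rf Rv Rg; split=> // x; rewrite /= eq_double1.
  apply: steps_cons; first by apply: (steps1 H1); reflexivity.
  apply: (steps1 H2) => /=.
  case: (R) => Rf Rv Rg; rewrite !Rf Hr Hl /eval_op.
  by rewrite (_ : (i < n) = false) /= ?mod0n //; lia.
have lt_in : i < n by lia.
set f1 := [eta f with 1 |-> 1 %% 2 ^ w].
have R1 : represents w v g f1.
  by case: R => Rf Rv Rg; split=> // x; rewrite /f1 /= eq_double1.
have HQ4' : contains Q (off + 3) (compile (off + 3) c).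
  by rewrite [X in contains _ X _]addn3.
have [t1 [v2 [g2 [f2 [L2 S2 R2 [I2 r2 l2]]]]]] :=
  Hc i lt_in _ _ v g f1 HQ4' R1 (And3 HI Hr Hl).
set f3 := [eta [eta f2 with 1 |-> 1 %% 2 ^ w] with r.*2 |-> i.+1].
set f4 := [eta f3 with 1 |-> 0 %% 2 ^ w].
have R4 : represents w (upd v2 r i.+1) g2 f4.
  case: R2 => Rf Rv Rg; split=> // x; rewrite /upd /f4 /f3 /=.
    by rewrite eq_double1 eq_double; case: eqP.
  by case: eqP => // _; lia.
have [|||t5 [v5 [g5 [f5 [L5 S5 R5 X5]]]]] :=
  IH i.+1 (upd v2 r i.+1) g2 f4 _ R4 I2.
- by rewrite -Hi addnS.
- by rewrite /upd /= eqxx.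
- by rewrite /upd /= eq_sym (negbTE Nrl).
exists (2 + t1 + 4 + t5), v5, g5, f5; split=> //; first lia.
apply: steps_trans S5.
have small1 : 1 %% 2 ^ w = 1 by rewrite modn_small //; lia.
apply: (@steps_trans _ _ _ _ _ (State (off + 3 + csize c) f2 g2)).
  apply: steps_trans S2.
  apply: steps_cons; first by apply: (steps1 H1); reflexivity.
  apply: (steps1 H2) => /=.
  case: (R) => Rf Rv Rg; rewrite !Rf Hr Hl /eval_op lt_in /= /f1 !small1 /=.
  by congr (State _ _ _); lia.
rewrite size_compile in H5 H6 H7 H8.
have e3 : off + 3 + csize c = off.+3 + csize c by lia.
rewrite e3.
apply: steps_cons; first by apply: (steps1 H5); reflexivity.
apply: (@steps_cons _ _ _ _ (State (off.+3 + csize c).+2 f3 g2)).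
  apply: (steps1 H6); congr (State _ _ _); rewrite /f3 /=.
  rewrite eq_double1; case: (R2) => Rf Rv Rg.
  by rewrite /eval_op Rf r2 small1 addn1 modn_small //; lia.
apply: (@steps_cons _ _ _ _ (State (off.+3 + csize c).+3 f4 g2)).
  by apply: (steps1 H7).
by apply: (steps1 H8); rewrite /f4 /= mod0n.
Qed.

(** * Simulating a program on shorter words *)

(** A program names finitely many registers, so its register file fits into [M] variables of the
    simulating program. *)
Definition instr_lt (M : nat) (i : instr) : bool :=
  match i with
  | Const r _ => r < M
  | Op _ r r1 r2 => [&& r < M, r1 < M & r2 < M]
  | Read r r1 => (r < M) && (r1 < M)
  | Write r1 r2 => (r1 < M) && (r2 < M)
  | Jz r _ => r < M
  | Halt => true
  end.

Lemma instr_lt_bound (P : program) : exists2 M, 0 < M & all (instr_lt M) P.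
Proof.
elim: P => [|i P [M M0 HM]]; first by exists 1.
have mono M1 M2 j : M1 <= M2 -> instr_lt M1 j -> instr_lt M2 j.
  case: j => //= *; lia.
have [Mi Hi] : exists Mi, instr_lt Mi i.
  case: i => [r a|o r r1 r2|r r1|r1 r2|r l|] /=.
  - by exists r.+1.
  - exists (r + r1 + r2).+1; lia.
  - exists (r + r1).+1; lia.
  - exists (r1 + r2).+1; lia.
  - by exists r.+1.
  - by exists 0.
exists (M + Mi); first lia.
rewrite /= (mono _ _ _ _ Hi) ?leq_addl //=.
by apply: sub_all HM => j; apply: mono; rewrite leq_addr.
Qed.

(** [2 ^ wp] divides [2 ^ w], so reducing twice is reducing once. Subtraction is the only operation
    whose formula mentions the word size, and the two formulas differ by [2 ^ w - 2 ^ wp], a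
    multiple of [2 ^ wp]. *)
Lemma eval_op_mod w wp o a b : wp <= w -> a < 2 ^ wp -> b < 2 ^ wp ->
  eval_op w o a b %% 2 ^ wp = eval_op wp o a b.
Proof.
move=> le_w ltA ltB; rewrite /eval_op modn_dvdm ?dvdn_exp2l //.
case: o => //=.
have le2 : 2 ^ wp <= 2 ^ w by rewrite leq_exp2l.
have -> : a + (2 ^ w - b) = (2 ^ w - 2 ^ wp) + (a + (2 ^ wp - b)) by lia.
rewrite -(modnDml (2 ^ w - 2 ^ wp)).
by rewrite (eqP (dvdn_sub (dvdn_exp2l 2 le_w) (dvdnn _))) add0n.
Qed.

Lemma eval_Omod w wp x : wp <= w ->
  eval_op w Omod x (2 ^ wp) = x %% 2 ^ wp.
Proof.
move=> le_w; rewrite /eval_op modn_small //.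
by rewrite (leq_trans (ltn_pmod _ (pow2_gt0 wp))) // leq_exp2l.
Qed.

Definition wfs wp (s : state) : Prop :=
  (forall r, regs s r < 2 ^ wp) /\ (forall a, memory s a < 2 ^ wp).

Lemma wfs_init wp input : wfs wp (init wp input).
Proof. by split=> x /=; rewrite ?ltn_mod ?pow2_gt0. Qed.

(* [w] and [wp] are the word sizes of the simulating and of the simulated
   machine, [b] is the address of the simulated memory. *)
Definition simrel (w wp M v0 b : nat) (va ga : nat -> nat) (s : state)
    (v g f : nat -> nat) : Prop :=
  [/\ [/\ represents w v g f, wfs wp s & forall r, r < v0 -> v r = va r],
      forall r, r < M -> v (v0 + r) = regs s r,
      forall a, a < 2 ^ wp -> g (b + a) = memory s a &
      forall a, ~~ (b <= a < b + 2 ^ wp) -> g a = ga a].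

Lemma simrel_temp w wp M v0 b va ga s v g f x : x < 2 ^ w ->
  simrel w wp M v0 b va ga s v g f ->
  simrel w wp M v0 b va ga s v g [eta f with 1 |-> x].
Proof.
move=> Hx [[[Hf Hv Hg] H1 H2] H3 H4 H5]; split=> //; split=> //; split=> //.
by move=> r /=; rewrite eq_double1.
Qed.

Lemma simrel_asg w wp M v0 b va ga i j h m v g f r x : wp <= w ->
  x < 2 ^ wp ->
  simrel w wp M v0 b va ga (State i h m) v g f ->
  simrel w wp M v0 b va ga (State j [eta h with r |-> x] m)
    (upd v (v0 + r) x) g [eta f with (v0 + r).*2 |-> x].
Proof.
move=> le_w Hx [[[Hf Hv Hg] [H1 H1'] H2] H3 H4 H5].
have Hx' : x < 2 ^ w by rewrite (leq_trans Hx) // leq_exp2l.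
split=> //; first split=> //; first split=> //.
- by move=> y; rewrite /upd /= eq_double Hf.
- by move=> y; rewrite /upd /=; case: eqP.
- by split=> //= y; case: eqP.
- by move=> y Hy; rewrite /upd /= H2 //; case: eqP => // E; lia.
- by move=> y Hy; rewrite /upd /= eqn_add2l H3.
Qed.

Lemma simrel_store w wp M v0 b va ga i j h m v g f a x : wp <= w ->
  a < 2 ^ wp -> x < 2 ^ wp ->
  simrel w wp M v0 b va ga (State i h m) v g f ->
  simrel w wp M v0 b va ga (State j h [eta m with a |-> x])
    v (upd g (b + a) x) f.
Proof.
move=> le_w Ha Hx [[[Hf Hv Hg] [H1 H1'] H2] H3 H4 H5].
have Hx' : x < 2 ^ w by rewrite (leq_trans Hx) // leq_exp2l.
split=> //; first split=> //; first split=> //.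
- by move=> y; rewrite /upd /=; case: eqP.
- by split=> //= y; case: eqP.
- by move=> y Hy; rewrite /upd /= eqn_add2l H4.
- move=> y Hy; rewrite /upd /= H5 //; case: eqP => // E.
  by move: Hy; rewrite E leq_addr ltn_add2l Ha.
Qed.

Lemma sim_fetch Q off vb vw v0 (P : program) i :
  contains Q off (compile off (Sim P vb vw v0)) -> i < size P ->
  let c := csim vb vw v0 off (off + (size P).*2) (size P) (nth Halt P i) in
  nth Halt Q (off + i.*2) = nth Halt c 0 /\
  nth Halt Q (off + i.*2).+1 = nth Halt c 1.
Proof.
move=> HQ Hi c.
have Hs j : j < 2 -> nth Halt Q (off + i.*2 + j) = nth Halt c j.
  move=> Hj; rewrite -addnA HQ; last first.
    by rewrite size_compile /=; lia.
  by rewrite /= (nth_flatten2 Halt Halt) // => x; exact: size_csim.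
by rewrite -(Hs 0) // -(Hs 1) // addn0 addn1.
Qed.

(** The [minn] identifies all program counters past the end of [P]: each denotes a halted state, and
    all are sent to the end of the compiled code. *)
Lemma sim_step w wp Q off vb vw v0 P M b va ga s v g f :
  contains Q off (compile off (Sim P vb vw v0)) -> all (instr_lt M) P ->
  vb < v0 -> vw < v0 -> va vb = b -> va vw = 2 ^ wp -> b + 2 ^ wp <= 2 ^ w ->
  ~~ halted P s -> simrel w wp M v0 b va ga s v g f ->
  exists t v' g' f', [/\ t <= 2,
    steps w Q t (State (off + (minn (pc s) (size P)).*2) f g)
      (State (off + (minn (pc (step wp P s)) (size P)).*2) f' g') &
    simrel w wp M v0 b va ga (step wp P s) v' g' f'].
Proof.
case: s => i h m HQ HM ltvb ltvw Eb Ew Hb.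
rewrite /halted /step /fetch /=.
have [Hi|Hi] := leqP (size P) i; first by rewrite nth_default.
have HMi := all_nthP Halt HM _ Hi.
have [] := sim_fetch HQ Hi.
have pw1 : 0 < 2 ^ wp := pow2_gt0 wp.
have lew : wp <= w by rewrite -(leq_exp2l _ _ (ltnSn 1)); lia.
have e2 : off + (minn i.+1 (size P)).*2 = (off + i.*2).+2.
  by rewrite (minn_idPl Hi); lia.
case: (nth Halt P i) HMi => [r a|op r r1 r2|r r1|r1 r2|r l|] //= HMi Q1 Q2 _ S;
  rewrite ?e2; (have lt_wp : 2 ^ wp < 2 ^ w
    by case: (S) => [[[_ Hv _] _ H2] _ _ _]; rewrite -Ew -(H2 _ ltvw)).
- have [[[Hf Hv Hg] _ H2] _ _ _] := S.
  have S' := simrel_asg i.+1 r lew (ltn_pmod a pw1) S.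
  do 4 eexists; split; [ | | exact: S']; first exact: leqnn.
  apply: steps_cons; first by apply: (steps1 Q1); reflexivity.
  apply: (steps1 Q2) => /=; congr (State _ _ _); apply/funext => y /=.
  case: eqP => // _; rewrite eqxx eq_double.
  rewrite (_ : vw == v0 + r = false); last by apply/eqP; lia.
  by rewrite Hf (H2 _ ltvw) Ew eval_Omod // modn_dvdm ?dvdn_exp2l.
- have [[[Hf Hv Hg] [W1 _] H2] H3 _ _] := S; case/and3P: HMi => M0 M1 M2.
  have S' := simrel_asg i.+1 r lew (eval_op_lt wp op (h r1) (h r2)) S.
  do 4 eexists; split; [ | | exact: S']; first exact: leqnn.
  apply: steps_cons; first by apply: (steps1 Q1); reflexivity.
  apply: (steps1 Q2) => /=; congr (State _ _ _); apply/funext => y /=.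
  case: eqP => // _; rewrite eqxx eq_double.
  rewrite (_ : vw == v0 + r = false); last by apply/eqP; lia.
  by rewrite !Hf (H2 _ ltvw) Ew !H3 //= eval_Omod // eval_op_mod ?W1 //; exact: W1.
- have [[[Hf Hv Hg] [W1 W2] H2] H3 H4 _] := S; case/andP: HMi => M0 M1.
  have S0 := simrel_temp (eval_op_lt w Oadd b (h r1)) S.
  have S' := simrel_asg i.+1 r lew (W2 (h r1)) S0.
  do 4 eexists; split; [ | | exact: S']; first exact: leqnn.
  apply: steps_cons; first by apply: (steps1 Q1); reflexivity.
  apply: (steps1 Q2) => /=; congr (State _ _ _); apply/funext => y /=.
  case: eqP => // _; rewrite !Hf (H2 _ ltvb) H3 // Eb //= /eval_op modn_small.
    by apply: H4; exact: W1.
  by have /= := W1 r1; lia.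
- have [[[Hf Hv Hg] [W1 W2] H2] H3 H4 _] := S; case/andP: HMi => M0 M1.
  have S0 := simrel_temp (eval_op_lt w Oadd b (h r1)) S.
  have S' := simrel_store i.+1 lew (W1 r1) (W1 r2) S0.
  do 4 eexists; split; [ | | exact: S']; first exact: leqnn.
  apply: steps_cons; first by apply: (steps1 Q1); reflexivity.
  apply: (steps1 Q2) => /=.
  rewrite ?eq_double1 !Hf (H2 _ ltvb) !H3 // Eb /=.
  rewrite (_ : eval_op w Oadd b (h r1) = b + h r1) // /eval_op modn_small //.
  by have /= := W1 r1; lia.
- have [[[Hf Hv Hg] [W1 W2] H2] H3 H4 _] := S.
  have := Hf (v0 + r); rewrite H3 //= => Er.
  case: eqP => [h0|hn].
    exists 1, v, g, f; split=> //.
    by apply: (steps1 Q1); rewrite Er h0.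
  exists 2, v, g, [eta f with 1 |-> 0 %% 2 ^ w]; split=> //; last first.
    by apply: simrel_temp => //; rewrite ltn_mod pow2_gt0.
  apply: steps_cons.
    by apply: (steps1 Q1); rewrite Er (introF eqP hn); reflexivity.
  by apply: (steps1 Q2); rewrite e2.
Qed.

(** The two extra steps execute a compiled [Halt]. If the simulated machine stops before time [t],
    the remaining iterations are constant and nothing is simulated for them. *)
Lemma sim_run w wp Q off vb vw v0 P M b va ga t s v g f :
  contains Q off (compile off (Sim P vb vw v0)) -> all (instr_lt M) P ->
  vb < v0 -> vw < v0 -> va vb = b -> va vw = 2 ^ wp -> b + 2 ^ wp <= 2 ^ w ->
  halted P (iter t (step wp P) s) -> simrel w wp M v0 b va ga s v g f ->
  exists t' v' g' f', [/\ t' <= t.*2.+2,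
    steps w Q t' (State (off + (minn (pc s) (size P)).*2) f g)
      (State (off + (size P).*2) f' g') &
    simrel w wp M v0 b va ga (iter t (step wp P) s) v' g' f'].
Proof.
move=> HQ HM ltvb ltvw Eb Ew Hb.
have base s0 v1 g1 f1 t0 : halted P s0 -> simrel w wp M v0 b va ga s0 v1 g1 f1 ->
    exists t' v' g' f', [/\ t' <= t0.*2.+2,
    steps w Q t' (State (off + (minn (pc s0) (size P)).*2) f1 g1)
      (State (off + (size P).*2) f' g') &
    simrel w wp M v0 b va ga s0 v' g' f'].
  move=> Hh S; have [Hi|Hi] := leqP (size P) (pc s0).
    by exists 0, v1, g1, f1; split.
  have [] := sim_fetch HQ Hi.
  move: Hh; rewrite /halted /fetch; case: (nth Halt P (pc s0)) => //= _ Q1 Q2.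
  exists 2, v1, g1, [eta f1 with 1 |-> 0 %% 2 ^ w]; split=> //; last first.
    by apply: simrel_temp => //; rewrite ltn_mod pow2_gt0.
  apply: steps_cons; first by apply: (steps1 Q1); reflexivity.
  by apply: (steps1 Q2); rewrite /= mod0n.
elim: t s v g f => [|t IH] s v g f; first exact: base.
have [Hs|Hs] := boolP (halted P s).
  have fixs : step wp P s = s.
    by case: s Hs => i h m; rewrite /halted /step; case: (fetch _ _).
  by rewrite iter_fix //; apply: base.
rewrite iterSr => Hh S.
have [t1 [v1 [g1 [f1 [L1 S1 R1]]]]] := sim_step HQ HM ltvb ltvw Eb Ew Hb Hs S.
have [t2 [v2 [g2 [f2 [L2 S2 R2]]]]] := IH _ _ _ _ Hh R1.
exists (t1 + t2), v2, g2, f2; split=> //; first lia.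
exact: steps_trans S1 S2.
Qed.

(** The precondition says that the block looks like [init]: input first, zeros after. Of the final
    state only register 0 and everything outside the block are kept; the block and the other
    simulated registers are given up as garbage. *)
Lemma triple_sim w wp P vb vw v0 M b va ga input t s : 0 < M ->
  all (instr_lt M) P -> vb < v0 -> vw < v0 -> va vb = b -> va vw = 2 ^ wp ->
  b + 2 ^ wp <= 2 ^ w -> s = run wp P input t -> halted P s ->
  triple w
    (fun v g => [/\ forall r, r < v0 -> v r = va r,
       forall r, r < M -> v (v0 + r) = 0,
       forall a, a < 2 ^ wp -> g (b + a) = nth 0 input a %% 2 ^ wp &
       forall a, ~~ (b <= a < b + 2 ^ wp) -> g a = ga a])
    (Sim P vb vw v0)
    (fun v g => [/\ forall r, r < v0 -> v r = va r, v v0 = regs s 0 &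
       forall a, ~~ (b <= a < b + 2 ^ wp) -> g a = ga a])
    t.*2.+2.
Proof.
move=> M0 HM Lb Lw Eb Ew Hb -> Hh Q off v g f HQ R [H1 H2 H3 H4].
have S : simrel w wp M v0 b va ga (init wp input) v g f.
  by split=> //; split=> //; exact: wfs_init.
have [t' [v' [g' [f' [L1 S1 [[R1 _ V1] V2 _ G]]]]]] :=
  sim_run HQ HM Lb Lw Eb Ew Hb Hh S.
exists t', v', g', f'; split=> //.
  by move: S1; rewrite /= min0n addn0.
by split=> //; rewrite -[v0 in LHS]addn0 V2.
Qed.

(** * Colourings *)

Definition digit (b x e : nat) : nat := (x %/ b ^ e) %% b.

Lemma digits_exist (b : nat) (D : nat -> nat) N : 0 < b ->
  (forall e, D e < b) ->
  exists2 x, x < b ^ N & forall e, e < N -> digit b x e = D e.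
Proof.
move=> b0; elim: N D => [|N IH] D HD; first by exists 0.
have [x Hx E] := IH (fun e => D e.+1) (fun e => HD e.+1).
exists (x * b + D 0).
  by rewrite expnS; have := HD 0; nia.
case=> [_|e He]; rewrite /digit.
  by rewrite expn0 divn1 modnMDl modn_small.
by rewrite expnS divnMA divnMDl // (divn_small (HD 0)) addn0 -/(digit b x e) E.
Qed.

(* The digit [d] stands for the bit number [d %/ 2], flipped when [d] is odd. *)
Definition tst (d v : nat) : nat := (v %/ 2 ^ (d %/ 2) + d) %% 2.

Lemma tst_lt2 d v : tst d v < 2.
Proof. by rewrite /tst ltn_mod. Qed.

Lemma bit_differs B u v : u < 2 ^ B -> v < 2 ^ B -> u != v ->
  exists2 b, b < B & (u %/ 2 ^ b) %% 2 != (v %/ 2 ^ b) %% 2.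
Proof.
elim: B u v => [|B IH] u v Hu Hv Huv; first by move: Hu Hv Huv; rewrite expn0; lia.
have [E|N] := eqVneq (u %% 2) (v %% 2); last first.
  by exists 0 => //; rewrite expn0 !divn1.
have [|||b Hb Nb] := IH (u %/ 2) (v %/ 2).
- by rewrite ltn_divLR // -expnSr.
- by rewrite ltn_divLR // -expnSr.
- by apply: contraNneq Huv => E2; rewrite (divn_eq u 2) (divn_eq v 2) E E2.
by exists b.+1 => //; rewrite expnS !divnMA.
Qed.

Lemma tst_separates B u v : u < 2 ^ B -> v < 2 ^ B -> u != v ->
  exists d, [/\ d < 2 * B, tst d u = 0 & tst d v = 1].
Proof.
move=> Hu Hv Huv; have [b Hb Nb] := bit_differs Hu Hv Huv.
have [E|E] := eqVneq ((u %/ 2 ^ b) %% 2) 0.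
  exists (b * 2); split; first lia.
    by rewrite /tst mulnK // addnC modnMDl.
  by rewrite /tst mulnK // addnC modnMDl; lia.
exists (b * 2 + 1); split; first lia.
  by rewrite /tst divnMDl // addn0 addnC -addnA modnMDl; lia.
by rewrite /tst divnMDl // addn0 addnC -addnA modnMDl; lia.
Qed.

(** The index [e] encodes the ordered pair of colours [(e %/ k, e %% k)]; diagonal pairs impose
    nothing. Products with 0/1 values replace case analysis, so that a branch-free machine
    expression can compute it. *)
Definition vterm (k b x i v e : nat) : nat :=
  if e %/ k == e %% k then 0
  else (i == e %/ k) * tst (digit b x e) v +
       (i == e %% k) * (1 - tst (digit b x e) v).

(* Number of constraints that [v] violates when it is given colour [i]; the
   digit [a * k + b] of [x] must separate the colours [a] and [b]. *)
Definition viol (k b x i v : nat) : nat :=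
  sumn [seq vterm k b x i v e | e <- iota 0 (k * k)].

Lemma vterm_le2 k b x i v e : vterm k b x i v e <= 2.
Proof.
rewrite /vterm; case: ifP => // _; have := tst_lt2 (digit b x e) v.
by case: (i == _); case: (i == _); lia.
Qed.

Lemma viol_le k b x i v : viol k b x i v <= 2 * (k * k).
Proof.
rewrite /viol -[k * k in leqRHS](size_iota 0).
by elim: (iota _ _) => //= e s IH; have := vterm_le2 k b x i v e; lia.
Qed.

Lemma viol_eq0 k b x i v : (viol k b x i v == 0) =
  all (fun e => vterm k b x i v e == 0) (iota 0 (k * k)).
Proof.
by rewrite /viol; elim: (iota _ _) => //= e s <-; rewrite addn_eq0.
Qed.

(** The digit of the pair [(i, j)] requires the same test to give 0 for colour [i] and 1 for colour
    [j]. *)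
Lemma viol_disjoint k b x i j v : i < k -> j < k -> i != j ->
  viol k b x i v = 0 -> viol k b x j v = 0 -> False.
Proof.
move=> Hi Hj Nij /eqP; rewrite viol_eq0 => /allP Vi /eqP.
rewrite viol_eq0 => /allP Vj.
have k0 : 0 < k by lia.
have He : i * k + j \in iota 0 (k * k) by rewrite mem_iota; nia.
have := Vi _ He; have := Vj _ He.
have Ed : (i * k + j) %/ k = i by rewrite divnMDl // (divn_small Hj) addn0.
have Em : (i * k + j) %% k = j by rewrite modnMDl modn_small.
rewrite /vterm Ed Em (negbTE Nij) !eqxx [j == i]eq_sym (negbTE Nij).
by have := tst_lt2 (digit b x (i * k + j)) v; lia.
Qed.

(** Each ordered pair of colours owns a digit, so the separating tests can be chosen independently
    and then assembled into one number. *)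
Lemma viol_complete k B (u : nat -> nat) : 0 < B ->
  (forall i, i < k -> u i < 2 ^ B) ->
  (forall i j, i < k -> j < k -> i != j -> u i != u j) ->
  exists2 x, x < (2 * B) ^ (k * k) &
    forall i, i < k -> viol k (2 * B) x i (u i) = 0.
Proof.
move=> B0 Hu Nu.
have /choice[D HD] : forall e, exists d, d < 2 * B /\
    (e < k * k -> e %/ k != e %% k ->
     tst d (u (e %/ k)) = 0 /\ tst d (u (e %% k)) = 1).
  move=> e; case: (boolP ((e < k * k) && (e %/ k != e %% k))) => [/andP[He Ne]|H].
    have k0 : 0 < k by nia.
    have H1 : e %/ k < k by rewrite ltn_divLR.
    have H2 : e %% k < k by rewrite ltn_mod.
    have [d [? ? ?]] := tst_separates (Hu _ H1) (Hu _ H2) (Nu _ _ H1 H2 Ne).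
    by exists d.
  by exists 0; split; [lia | move=> H1 H2; rewrite H1 H2 in H].
have [||x Hx E] := @digits_exist (2 * B) D (k * k); first lia.
  by move=> e; case: (HD e).
exists x => // i Hi; apply/eqP; rewrite viol_eq0; apply/allP => e.
rewrite mem_iota /= add0n => He; rewrite /vterm; case: ifPn => // Ne.
have [_ /(_ He Ne) [T1 T2]] := HD e; rewrite E //.
have [->|Na] := eqVneq i (e %/ k); first by rewrite T1 (negbTE Ne).
by have [->|Nb] := eqVneq i (e %% k); rewrite ?T2.
Qed.

(** * The layered graph *)

Definition adjl (L : seq (nat * nat)) : rel nat := fun a b => (a, b) \in L.

(* The vertex [v] of layer [i] is [i * n2 + v]; the last vertex [nz] is a sink
   reached from everywhere, which makes the graph dense enough.  An arc that
   does not respect the colouring is redirected to a private dead end. *)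
Definition arcf (k n2 b x : nat) (us vs : nat -> nat) (q : nat) : nat * nat :=
  let i := q %% k in let u := us (q %/ k) in let v := vs (q %/ k) in
  (i * n2 + u,
   if viol k b x i u + viol k b x (i.+1 %% k) v == 0 then i.+1 * n2 + v
   else k.+1 * n2 + q).

Definition nzv (k n2 m : nat) : nat := k.+1 * n2 + k * m.

Definition larcs (k n2 b x m : nat) (us vs : nat -> nat) : seq (nat * nat) :=
  [seq (v, nzv k n2 m) | v <- iota 0 (nzv k n2 m)] ++
  [seq arcf k n2 b x us vs q | q <- iota 0 (k * m)].

Definition lpairs (k n2 : nat) : seq (nat * nat) :=
  [seq (v, k * n2 + v) | v <- iota 0 n2].

Lemma size_larcs k n2 b x m us vs :
  size (larcs k n2 b x m us vs) = nzv k n2 m + k * m.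
Proof. by rewrite size_cat !size_map !size_iota. Qed.

Lemma adjl_larcs k n2 b x m us vs a c :
  adjl (larcs k n2 b x m us vs) a c ->
  (c = nzv k n2 m /\ a < nzv k n2 m) \/
  exists2 q, q < k * m & (a, c) = arcf k n2 b x us vs q.
Proof.
rewrite /adjl mem_cat => /orP[] /mapP[q]; rewrite mem_iota /= add0n => Hq.
  by case=> -> ->; left.
by move=> E; right; exists q.
Qed.

Lemma edivn_uniq (n2 i j u v : nat) : u < n2 -> v < n2 ->
  i * n2 + u = j * n2 + v -> i = j /\ u = v.
Proof.
move=> Hu Hv E; have n0 : 0 < n2 by lia.
split; [have /= := congr1 (divn^~ n2) E | have := congr1 (modn^~ n2) E].
  by rewrite !divnMDl // (divn_small Hu) (divn_small Hv) !addn0.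
by rewrite /= !modnMDl !modn_small.
Qed.

Section LayeredGraph.
Variables (k n2 b x m : nat) (us vs : nat -> nat).
Hypothesis k_gt0 : 0 < k.
Hypothesis us_lt : forall j, j < m -> us j < n2.
Hypothesis vs_lt : forall j, j < m -> vs j < n2.
Hypothesis inj_uvs : forall j j', j < m -> j' < m ->
  us j = us j' -> vs j = vs j' -> j = j'.

Let nz := nzv k n2 m.
Let L := larcs k n2 b x m us vs.

Let q_divP q : q < k * m -> q %/ k < m /\ q %% k < k.
Proof. by move=> H; rewrite ltn_divLR // mulnC ltn_mod. Qed.

Lemma arcf_bounds q : q < k * m ->
  [/\ (arcf k n2 b x us vs q).1 < k * n2,
      (arcf k n2 b x us vs q).2 < nz &
      (arcf k n2 b x us vs q).1 < (arcf k n2 b x us vs q).2].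
Proof.
move=> Hq; have [Hj Hi] := q_divP Hq.
have := us_lt Hj; have := vs_lt Hj; rewrite /arcf /nz /nzv /=.
by case: ifP => _ ? ?; split; nia.
Qed.

Lemma larcs_bounds : all (fun a => [&& a.1 < nz.+1, a.2 < nz.+1 & a.1 != a.2]) L.
Proof.
rewrite all_cat; apply/andP; split; apply/allP => a /mapP[q].
  by rewrite mem_iota /= add0n => Hq -> /=; rewrite -/nz in Hq *; lia.
rewrite mem_iota /= add0n => Hq ->.
by have [? ? ?] := arcf_bounds Hq; lia.
Qed.

(** A respected arc determines its layer and both endpoints, hence [q]; a redirected arc shows [q]
    in its dead end. The two kinds, and the arcs into the sink, are told apart by the range of their
    targets. *)
Lemma uniq_larcs : uniq L.
Proof.
rewrite cat_uniq; apply/and3P; split.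
- by rewrite map_inj_uniq ?iota_uniq // => v v' [].
- apply/hasPn => a /mapP[q]; rewrite mem_iota /= add0n => Hq ->.
  apply/mapP => -[v _ E]; have [_ H _] := arcf_bounds Hq.
  by move: H; rewrite E /= ltnn.
rewrite map_inj_in_uniq ?iota_uniq // => q q'.
rewrite !mem_iota /= !add0n => Hq Hq'.
have [Hj Hi] := q_divP Hq; have [Hj' Hi'] := q_divP Hq'.
have u1 := us_lt Hj; have u1' := us_lt Hj'.
have v1 := vs_lt Hj; have v1' := vs_lt Hj'.
rewrite /arcf; set g := (_ == 0); set g' := (_ == 0).
case=> /(edivn_uniq u1 u1') [Ei Eu].
have bnd i v q0 : i < k -> v < n2 -> i.+1 * n2 + v = k.+1 * n2 + q0 -> False.
  by move=> ? ? ?; nia.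
case: (g); case: (g') => E.
- have [_ Ev] := edivn_uniq v1 v1' E.
  by rewrite (divn_eq q k) (divn_eq q' k) (inj_uvs Hj Hj' Eu Ev) Ei.
- by case: (bnd _ _ _ Hi v1 E).
- by case: (bnd _ _ _ Hi' v1' (esym E)).
- by apply/eqP; rewrite -(eqn_add2l (k.+1 * n2)) E.
Qed.

(** The remainder makes the last layer, number [k], carry colour 0 again. *)
Definition lstep (t u v : nat) : Prop :=
  exists j, [/\ j < m, us j = u, vs j = v &
    viol k b x t u + viol k b x (t.+1 %% k) v = 0].

(** Past the layers, a dead end leads only to the sink and the sink leads nowhere, so a walk that
    leaves the layers never returns. *)
Lemma path_sink a p : k.+1 * n2 <= a -> path (adjl L) a p ->
  k.+1 * n2 <= last a p.
Proof.
elim: p a => //= c p IH a Ha /andP[/adjl_larcs [[Ec _]|[q Hq E]] Hp].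
  by apply: IH Hp; rewrite Ec /nzv leq_addr.
have [H _ _] := arcf_bounds Hq; move: H Ha; rewrite -E /= => H Ha.
by exfalso; nia.
Qed.

Lemma path_layers i u p w : i <= k -> u < n2 -> w < n2 ->
  path (adjl L) (i * n2 + u) p -> last (i * n2 + u) p = k * n2 + w ->
  exists f : nat -> nat, [/\ f i = u, f k = w &
    forall t, i <= t -> t < k -> lstep t (f t) (f t.+1)].
Proof.
move=> Hi Hu Hw; elim: p i u Hi Hu => [|c p IH] i u Hi Hu /=.
  move=> _ /(edivn_uniq Hu Hw) [-> ->]; exists (fun=> w); split=> // t; lia.
move=> /andP[/adjl_larcs A Hp] Hl.
(* The walk ends in layer [k], so its next vertex is neither a dead end nor the sink, and the arc
   taken must respect the colouring. *)
have small : c < k.+1 * n2.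
  rewrite ltnNge; apply/negP => /path_sink /(_ Hp); rewrite Hl; nia.
case: A => [[Ec _]|[q Hq]]; first by move: small; rewrite Ec /nzv; lia.
have [Hj Hi'] := q_divP Hq; rewrite /arcf; case: ifP => [/eqP G|_]; last first.
  by case=> _ Ec; move: small; rewrite Ec; lia.
case=> /(edivn_uniq Hu (us_lt Hj)) [Ei Eu] Ec.
rewrite -Ei in G Ec Hi'.
rewrite Ec in Hp Hl.
have [f [F1 F2 F3]] := IH i.+1 _ Hi' (vs_lt Hj) Hp Hl.
exists (fun t => if t == i then u else f t); split.
- by rewrite eqxx.
- by rewrite gtn_eqF.
move=> t Hit Htk; rewrite (gtn_eqF (Hit : i < t.+1)); case: eqP => [->|Nt].
  by exists (q %/ k); rewrite F1 Eu.
by apply: F3 => //; lia.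
Qed.

Lemma lstep_adj t u v : t < k -> lstep t u v ->
  adjl L (t * n2 + u) (t.+1 * n2 + v).
Proof.
move=> Ht [j [Hj Eu Ev G]]; rewrite /adjl mem_cat; apply/orP; right.
(* In the number [q] of a layered arc, the quotient by [k] is the original arc and the remainder is
   the layer. *)
apply/mapP; exists (j * k + t); first by rewrite mem_iota; nia.
by rewrite /arcf divnMDl // divn_small // addn0 modnMDl modn_small // Eu Ev G.
Qed.

Lemma path_of_lsteps (f : nat -> nat) : f k = f 0 ->
  (forall t, t < k -> lstep t (f t) (f t.+1)) ->
  exists2 p, path (adjl L) (f 0) p & last (f 0) p = k * n2 + f 0.
Proof.
move=> Ef H.
suff P n : n <= k -> exists2 p, path (adjl L) (f 0) p &
    last (f 0) p = n * n2 + f n.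
  by have [p] := P k (leqnn k); rewrite Ef; exists p.
elim: n => [|n IH] Hn; first by exists [::].
have [p Hp El] := IH (ltnW Hn).
exists (rcons p (n.+1 * n2 + f n.+1)); last by rewrite last_rcons.
by rewrite rcons_path Hp El; apply: lstep_adj => //; apply: H.
Qed.

End LayeredGraph.

(** * Cycles of the graph as walks in the layered graph *)

Lemma cycle_nth (T : Type) (e : rel T) x0 s :
  (forall i, i < size s -> e (nth x0 s i) (nth x0 s (i.+1 %% size s))) <->
  cycle e s.
Proof.
case: s => [|y p] //=; have sz : size (rcons p y) = (size p).+1 by rewrite size_rcons.
have key i : i < (size p).+1 ->
    nth x0 (y :: rcons p y) i = nth x0 (y :: p) i /\
    nth x0 (rcons p y) i = nth x0 (y :: p) (i.+1 %% (size p).+1).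
  move=> Hi; rewrite -rcons_cons !nth_rcons /= Hi; split=> //.
  have [Hi'|->] : i < size p \/ i = size p by lia.
    by rewrite Hi' modn_small.
  by rewrite ltnn eqxx modnn.
split=> [H|/(pathP x0) H i Hi].
  apply/(pathP x0) => i; rewrite sz => Hi.
  by have [-> ->] := key i Hi; apply: H.
by have [<- <-] := key i Hi; apply: H; rewrite sz.
Qed.

(** The renaming [tab] is injective only on endpoints of arcs, which suffices as a cycle visits no
    other vertex. Conversely, a walk from layer 0 to layer [k] gives [k] consecutive arcs that close
    up, and their sources are distinct because colour classes are disjoint. *)
Lemma has_kcycle_layered (G : digraph) (k n2 B : nat) (tab us vs : nat -> nat) :
  0 < k -> 0 < B -> n2 <= 2 ^ B ->
  (forall a, a \in arcs G -> tab (val a.1) < n2 /\ tab (val a.2) < n2) ->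
  (forall a c (y z : 'I_(nverts G)), a \in arcs G -> c \in arcs G ->
     (y == a.1) || (y == a.2) -> (z == c.1) || (z == c.2) ->
     tab (val y) = tab (val z) -> y = z) ->
  (forall a0 j, j < narcs G -> us j = tab (val (nth a0 (arcs G) j).1) /\
                               vs j = tab (val (nth a0 (arcs G) j).2)) ->
  has_kcycle k G <->
  exists x v p, [/\ x < (2 * B) ^ (k * k), v < n2,
    path (adjl (larcs k n2 (2 * B) x (narcs G) us vs)) v p &
    last v p = k * n2 + v].
Proof.
move=> k0 B0 n2B tabL tabI Huv; pose m := narcs G.
have arc j : j < m -> exists a, [/\ a \in arcs G, us j = tab (val a.1),
    vs j = tab (val a.2) & forall a0, nth a0 (arcs G) j = a].
  move=> Hj; case E: (arcs G) => [|a0 s]; first by rewrite /m /narcs E in Hj.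
  have [E1 E2] := Huv a0 _ Hj; exists (nth a0 (arcs G) j); split=> //.
    by rewrite -E mem_nth.
  by move=> a1; rewrite E; apply: set_nth_default; rewrite -E.
have usL j : j < m -> us j < n2.
  by move=> /arc[a [/tabL[H _] -> _ _]].
have vsL j : j < m -> vs j < n2.
  by move=> /arc[a [/tabL[_ H] _ -> _]].
split.
- case/existsP => c /andP[Cc Uc].
  have [x0 Ex0] : exists x0, x0 \in c.
    case: c {Cc Uc} => [[|y s] Hs]; last by exists y; rewrite inE eqxx.
    by exfalso; move: Hs k0 => /= /eqP <-.
  have Hc := (cycle_nth (@adj G) x0 c).2 Cc; rewrite size_tuple in Hc.
  (* Indices are taken modulo [k], so that the sequence of vertices closes up at [k] by itself. *)
  pose u i := tab (val (nth x0 c (i %% k))).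
  have Hmod i : i %% k < k by rewrite ltn_mod.
  have uE i : i < k -> u i = tab (val (nth x0 c i)).
    by move=> Hi; rewrite /u modn_small.
  have uL i : u i < n2 by have := tabL _ (Hc _ (Hmod i)); case.
  have [||x Hx Hv] := @viol_complete k B u B0.
  + by move=> i _; exact: leq_trans (uL i) n2B.
  + move=> i j Hi Hj; rewrite !uE //; apply: contra_neq => E.
    apply/eqP; rewrite -(nth_uniq x0 _ _ Uc) ?size_tuple //; apply/eqP.
    by apply: tabI (Hc _ Hi) (Hc _ Hj) _ _ E; rewrite eqxx.
  have [||p Hp Hl] := @path_of_lsteps k n2 (2 * B) x m us vs k0 u.
  + by rewrite /u modnn mod0n.
  + move=> t Ht; have Ha := Hc _ Ht.
    exists (index (nth x0 c t, nth x0 c (t.+1 %% k)) (arcs G)).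
    have Hi : index (nth x0 c t, nth x0 c (t.+1 %% k)) (arcs G) < narcs G.
      by rewrite /narcs index_mem.
    have [-> ->] := Huv (x0, x0) _ Hi; rewrite nth_index //=.
    split; [by [] | by rewrite uE | by [] |].
    rewrite Hv // add0n -[RHS](Hv _ (Hmod t.+1)).
    by rewrite /u modn_mod.
  by exists x, (u 0), p.
case=> x [v [p [Hx Hv Hp Hl]]].
have := @path_layers k n2 (2 * B) x m us vs k0 usL vsL 0 v p v (leq0n k) Hv Hv.
rewrite mul0n add0n => /(_ Hp Hl) [f [F0 Fk Hf]].
have /choice[a Ha] : forall i : 'I_k, exists a,
    [/\ a \in arcs G, tab (val a.1) = f i, tab (val a.2) = f i.+1 &
        viol k (2 * B) x i (f i) = 0].
  move=> i; have [j [Hj Eu Ev V]] := Hf i isT (ltn_ord i).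
  have [a [Aa Ea1 Ea2 _]] := arc _ Hj.
  by exists a; rewrite -Ea1 -Ea2 Eu Ev; split=> //; lia.
pose c := [tuple (a i).1 | i < k].
pose x0 := (a (Ordinal k0)).1.
have nthc (i : 'I_k) : nth x0 c i = (a i).1.
  by rewrite -tnth_nth tnth_mktuple.
apply/existsP; exists c; apply/andP; split.
  apply/(cycle_nth _ x0) => i; rewrite size_tuple => Hi.
  have Hi' : i.+1 %% k < k by rewrite ltn_mod.
  rewrite (nthc (Ordinal Hi)) (nthc (Ordinal Hi')) /adj.
  have [A1 A2 A3 _] := Ha (Ordinal Hi); have [A1' A2' _ _] := Ha (Ordinal Hi').
  suff -> : (a (Ordinal Hi')).1 = (a (Ordinal Hi)).2 by rewrite -surjective_pairing.
  apply: tabI A1' A1 _ _ _; rewrite ?eqxx ?orbT // A2' A3 /=.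
  have [->|Ni] := eqVneq i.+1 k; first by rewrite modnn F0 Fk.
  by rewrite modn_small //; lia.
rewrite map_inj_uniq ?enum_uniq // => i j E.
have [_ A2 _ Vi] := Ha i; have [_ A2' _ Vj] := Ha j.
(* A vertex occurring at two places of the cycle would have two different colours. *)
apply/eqP/negPn/negP => Nij.
apply: (viol_disjoint (ltn_ord i) (ltn_ord j) Nij Vi).
by rewrite -A2 E A2'.
Qed.

(** * Distances *)

Definition natpairs (n : nat) (s : seq ('I_n * 'I_n)) : seq (nat * nat) :=
  [seq (val a.1, val a.2) | a <- s].

Definition encode_list (s : seq (nat * nat)) : seq nat :=
  size s :: flatten [seq [:: a.1; a.2] | a <- s].

Lemma encode_pairsE n (s : seq ('I_n * 'I_n)) :
  encode_pairs s = encode_list (natpairs s).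
Proof. by rewrite /encode_pairs /encode_list /natpairs size_map -map_comp. Qed.

Lemma natpairs_lift N (L : seq (nat * nat)) :
  all (fun a => (a.1 < N.+1) && (a.2 < N.+1)) L ->
  exists s : seq ('I_N.+1 * 'I_N.+1), natpairs s = L.
Proof.
move=> HL; exists [seq (inord a.1, inord a.2) | a <- L].
rewrite /natpairs -map_comp -[RHS]map_id; apply/eq_in_map => -[a b] /(allP HL).
by move=> /andP[/= Ha Hb]; rewrite !inordK.
Qed.

Lemma path_natpairs (G : digraph) (u v : 'I_(nverts G)) :
  (exists p, path (@adj G) u p /\ last u p = v) <->
  (exists p, path (adjl (natpairs (arcs G))) (val u) p /\
             last (val u) p = val v).
Proof.
have adjE (a b : 'I_(nverts G)) :
    adjl (natpairs (arcs G)) (val a) (val b) = adj a b.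
  rewrite /adjl /adj /natpairs; apply/mapP/idP => [[[c d] H [Ea Eb]]|H].
    by rewrite (val_inj Ea) (val_inj Eb).
  by exists (a, b).
split=> -[p [Hp El]].
  exists (map val p); rewrite last_map El; split=> //.
  rewrite path_map; apply: sub_path Hp => a b; exact: (fun H => etrans (adjE a b) H).
elim: p u Hp El => [|c p IH] u /=; first by move=> _ /val_inj ->; exists [::].
case/andP => Huc Hp El; have := Huc; rewrite {1}/adjl => /mapP[[a d] _ [_ Ed]].
rewrite Ed in Huc Hp El; rewrite adjE in Huc.
have [q [Hq <-]] := IH d Hp El.
by exists (d :: q); rewrite /= Huc.
Qed.

Section MinDist.
Local Open Scope ereal_scope.
Local Open Scope classical_set_scope.

Lemma dist_ge0 (R : realType) (G : digraph) (s t : 'I_(nverts G)) :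
  0 <= dist R s t.
Proof. by apply: le_ereal_inf_tmp => _ [p _ <-]; rewrite lee_fin. Qed.

Lemma dist_ltoo (R : realType) (G : digraph) (s t : 'I_(nverts G)) :
  dist R s t < +oo <-> exists p, path (@adj G) s p /\ last s p = t.
Proof.
split=> [|[p Hp]]; last first.
  apply: (@le_lt_trans _ _ (size p)%:R%:E); last exact: ltry.
  by apply: ereal_inf_lbound; exists p.
by case/ereal_inf_lt => _ [p Hp _] _; exists p.
Qed.

Lemma min_dist_ge0 (R : realType) (G : digraph)
  (pairs : seq ('I_(nverts G) * 'I_(nverts G))) : 0 <= min_dist R pairs.
Proof.
rewrite /min_dist; elim: pairs => [|a s IH]; first by rewrite big_nil.
by rewrite big_cons le_min dist_ge0.
Qed.

Lemma min_dist_ltoo (R : realType) (G : digraph)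
  (pairs : seq ('I_(nverts G) * 'I_(nverts G))) :
  min_dist R pairs < +oo <-> exists2 a, a \in pairs & dist R a.1 a.2 < +oo.
Proof.
rewrite /min_dist; elim: pairs => [|a s IH].
  by rewrite big_nil ltxx; split=> // -[a].
rewrite big_cons gt_min; split.
  case/orP => [Ha|/IH[c Hc Hd]]; first by exists a; rewrite ?mem_head.
  by exists c; rewrite // inE Hc orbT.
case=> c; rewrite inE => /orP[/eqP -> -> //|Hc Hd].
by apply/orP; right; apply/IH; exists c.
Qed.

(** If [x] is finite, so is [alpha%:E * x], which excludes an infinite output; a finite output in
    turn bounds [x] from above. *)
Lemma output_finite (R : realType) (alpha : R) (s : state) (x : \bar R) :
  0 <= x -> x <= output R s <= alpha%:E * x ->
  (regs s 0 != 0)%N <-> x < +oo.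
Proof.
move=> x0; rewrite /output; case: eqP => /= [_|_] /andP[H1 H2].
  split=> // xoo; suff : alpha%:E * x < +oo by rewrite ltNge H2.
  by case: x x0 xoo {H1 H2} => // r _ _; rewrite -EFinM ltry.
by split=> // _; apply: le_lt_trans H1 (ltry _).
Qed.

(** The bridge from the lists of numbers that the machine writes to the dependently typed graphs of
    the specification. The pairs are quantified inside, since their type depends on the graph. *)
Lemma digraph_of_list (R : realType) N (L : seq (nat * nat)) :
  all (fun a => [&& a.1 < N.+1, a.2 < N.+1 & a.1 != a.2])%N L -> uniq L ->
  exists G : digraph, [/\ nverts G = N.+1, narcs G = size L,
    encode_digraph G = N.+1 :: encode_list L &
    forall Lp, all (fun a => (a.1 < N.+1) && (a.2 < N.+1))%N Lp ->
    exists pairs : seq ('I_(nverts G) * 'I_(nverts G)),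
      [/\ size pairs = size Lp, encode_pairs pairs = encode_list Lp &
      min_dist R pairs < +oo <-> exists a p, [/\ a \in Lp,
        path (adjl L) a.1 p & last a.1 p = a.2]]].
Proof.
move=> HL UL; have [|s Es] := @natpairs_lift N L.
  by apply: sub_all HL => a /and3P[-> ->].
have Us : uniq s by apply: (@map_uniq _ _ (fun a => (val a.1, val a.2))); rewrite -/(natpairs s) Es.
have Ls : all (fun a => a.1 != a.2) s.
  apply/allP => a Ha; have /and3P[_ _] : [&& val a.1 < N.+1, val a.2 < N.+1 & val a.1 != val a.2]%N.
    by apply: (allP HL (val a.1, val a.2)); rewrite -Es map_f.
  by [].
exists (Digraph Us Ls); split=> //.
- by rewrite /narcs /= -Es size_map.
- by rewrite /encode_digraph /= encode_pairsE Es.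
move=> Lp /natpairs_lift[sp Esp]; exists sp; split.
- by rewrite -Esp size_map.
- by rewrite encode_pairsE Esp.
split.
  case/min_dist_ltoo => a Ha /dist_ltoo /path_natpairs [p [Hp El]].
  exists (val a.1, val a.2), p; rewrite -Es; split=> //.
  by rewrite -Esp map_f.
case=> a [p]; rewrite -Esp -Es => -[/mapP[c Hc ->] /= Hp El].
apply/min_dist_ltoo; exists c => //; apply/dist_ltoo.
by apply/(@path_natpairs (Digraph Us Ls)); exists p.
Qed.

End MinDist.

(** * Evaluation without overflow *)

Section Evaluation.
Variables (w : nat) (v g : nat -> nat).
Local Notation ev := (eval_expr w v g).

Lemma ev_c a : a < 2 ^ w -> ev (EC a) = a.
Proof. exact: modn_small. Qed.

Lemma ev_m e a b : ev e = a -> g a = b -> ev (EL e) = b.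
Proof. by move=> /= ->. Qed.

Lemma ev_add e1 e2 a b : ev e1 = a -> ev e2 = b -> a + b < 2 ^ w ->
  ev (EO Oadd e1 e2) = a + b.
Proof. by move=> /= -> -> H; rewrite /eval_op modn_small. Qed.

Lemma ev_mul e1 e2 a b : ev e1 = a -> ev e2 = b -> a * b < 2 ^ w ->
  ev (EO Omul e1 e2) = a * b.
Proof. by move=> /= -> -> H; rewrite /eval_op modn_small. Qed.

Lemma ev_sub e1 e2 a b : ev e1 = a -> ev e2 = b -> b <= a -> a < 2 ^ w ->
  ev (EO Osub e1 e2) = a - b.
Proof.
move=> /= -> -> H1 H2; rewrite /eval_op.
have -> : a + (2 ^ w - b) = 2 ^ w + (a - b) by lia.
by rewrite modnDl modn_small //; lia.
Qed.

Lemma ev_div e1 e2 a b : ev e1 = a -> ev e2 = b -> a < 2 ^ w ->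
  ev (EO Odiv e1 e2) = a %/ b.
Proof.
move=> /= -> -> H; rewrite /eval_op modn_small //.
exact: leq_ltn_trans (leq_div _ _) H.
Qed.

Lemma ev_mod e1 e2 a b : ev e1 = a -> ev e2 = b -> a < 2 ^ w ->
  ev (EO Omod e1 e2) = a %% b.
Proof.
move=> /= -> -> H; rewrite /eval_op modn_small //.
exact: leq_ltn_trans (leq_mod _ _) H.
Qed.

Lemma ev_shr e1 e2 a b : ev e1 = a -> ev e2 = b -> a < 2 ^ w ->
  ev (EO Oshr e1 e2) = a %/ 2 ^ b.
Proof.
move=> /= -> -> H; rewrite /eval_op modn_small //.
exact: leq_ltn_trans (leq_div _ _) H.
Qed.

Lemma ev_lt e1 e2 a b : ev e1 = a -> ev e2 = b -> 1 < 2 ^ w ->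
  ev (EO Olt e1 e2) = (a < b).
Proof. by move=> /= -> -> H; rewrite /eval_op modn_small //; case: (a < b); lia. Qed.

Lemma ev_eq e1 e2 a b : ev e1 = a -> ev e2 = b -> 1 < 2 ^ w ->
  ev (EO Oeq e1 e2) = (a == b).
Proof. by move=> /= -> -> H; rewrite /eval_op modn_small //; case: (a == b); lia. Qed.

Definition epow r n : expr := iter n (EO Omul (EV r)) (EC 1).

Lemma ev_pow r n a : v r = a -> 0 < a -> 1 < 2 ^ w -> a ^ n < 2 ^ w ->
  ev (epow r n) = a ^ n.
Proof.
move=> Ha a0 w1; elim: n => [|n IH] Hn; first exact: ev_c.
rewrite expnS; apply: ev_mul => //; last by rewrite -expnS.
by apply: IH; apply: leq_ltn_trans Hn; rewrite leq_pexp2l.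
Qed.

(* Variables: 8 holds the base of the digits, 13 the colouring. *)
Definition edigit e := EO Omod (EO Odiv (EV 13) (epow 8 e)) (EV 8).

Definition etst d u := EO Omod (EO Oadd (EO Oshr u (EO Odiv d (EC 2))) d) (EC 2).

Definition evterm k i u e :=
  if e %/ k == e %% k then EC 0 else
  EO Oadd (EO Omul (EO Oeq i (EC (e %/ k))) (etst (edigit e) u))
    (EO Omul (EO Oeq i (EC (e %% k))) (EO Osub (EC 1) (etst (edigit e) u))).

(** As [k] is fixed, the sum over all digits unrolls into one expression of constant size, and no
    inner loop is required. *)
Definition eviol k i u :=
  foldr (fun e acc => EO Oadd (evterm k i u e) acc) (EC 0) (iota 0 (k * k)).

Lemma ev_viol k b x ei eu i u : 0 < b -> v 8 = b -> v 13 = x ->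
  ev ei = i -> ev eu = u -> b ^ (k * k) <= 2 ^ w -> x < 2 ^ w ->
  u + b < 2 ^ w -> 4 * (k * k) + k + 10 < 2 ^ w ->
  ev (eviol k ei eu) = viol k b x i u.
Proof.
move=> b0 Hb Hx Hi Hu Hbk Hxw Hub Hkw; rewrite /eviol /viol.
have term e : e < k * k -> ev (evterm k ei eu e) = vterm k b x i u e.
  move=> He; rewrite /evterm /vterm; case: ifP => _; first by apply: ev_c; lia.
  have k0 : 0 < k by case: (k) He => //; rewrite mul0n.
  have L1 : e %/ k < k by rewrite ltn_divLR.
  have L2 : e %% k < k by rewrite ltn_mod.
  have Ed : ev (edigit e) = digit b x e.
    have [b1|b1] := leqP b 1.
      have -> : digit b x e = 0 by rewrite /digit (_ : b = 1) ?modn1 //; lia.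
      rewrite /edigit /= Hb (_ : b = 1); last lia.
      by rewrite /eval_op modn1 mod0n.
    apply: ev_mod => //; last by apply: leq_ltn_trans (leq_div _ _) Hxw.
    apply: ev_div => //; apply: ev_pow => //; first lia.
    by apply: leq_trans Hbk; rewrite ltn_exp2l.
  have dL : digit b x e < b by rewrite ltn_mod.
  have Et : ev (etst (edigit e) eu) = tst (digit b x e) u.
    have L3 : u %/ 2 ^ (digit b x e %/ 2) <= u := leq_div _ _.
    apply: ev_mod; [|by apply: ev_c; lia|lia].
    apply: ev_add => //; last lia.
    apply: ev_shr => //; last lia.
    by apply: ev_div => //; [apply: ev_c; lia | lia].
  have t2 := tst_lt2 (digit b x e) u.
  have E1 : ev (EO Oeq ei (EC (e %/ k))) = (i == e %/ k).
    by apply: ev_eq Hi (ev_c _) _; lia.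
  have E2 : ev (EO Oeq ei (EC (e %% k))) = (i == e %% k).
    by apply: ev_eq Hi (ev_c _) _; lia.
  have E3 : ev (EO Osub (EC 1) (etst (edigit e) eu)) = 1 - tst (digit b x e) u.
    by apply: ev_sub => //; [apply: ev_c; lia | lia].
  apply: ev_add; [apply: ev_mul E1 Et _|apply: ev_mul E2 E3 _|];
    move: (tst _ _) t2 => [|[|//]] _;
    case: (i == e %/ k); case: (i == e %% k) => /=; lia.
have bnd s : sumn [seq vterm k b x i u e | e <- s] <= 2 * size s.
  by elim: s => //= e s IH; have := vterm_le2 k b x i u e; lia.
have : {in iota 0 (k * k), forall e, e < k * k}.
  by move=> e; rewrite mem_iota add0n.
have : size (iota 0 (k * k)) <= k * k by rewrite size_iota.
elim: (iota 0 (k * k)) => [|e s IH] /= Hs Hin; first by apply: ev_c; lia.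
apply: ev_add.
- by apply: term; apply: Hin; rewrite inE eqxx.
- by apply: IH => [|e' He']; [lia | apply: Hin; rewrite inE He' orbT].
- by have := bnd s; have := vterm_le2 k b x i u e; lia.
Qed.
End Evaluation.

(** * The detector *)

(* Variable 0 is the answer; 1 to 11 hold, in this order, the constants listed
   in [consts] below; 12 is the counter of the inner loops, 13 the colouring,
   14 the address of the instance being written, 15 its current length; the
   registers of the simulated program start at 16. *)
Definition seqs (s : seq cmd) : cmd := foldr Seq Skip s.

(** Variable 9 holds the modulus of the simulated words; [init] reduces the input in the same
    way. *)
Definition push (e : expr) : cmd :=
  Seq (Store (EO Oadd (EV 14) (EV 15)) (EO Omod e (EV 9)))
      (Asg 15 (EO Oadd (EV 15) (EC 1))).

Definition push_loop (lim : nat) (e1 e2 : expr) : cmd :=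
  For 12 lim (Seq (push e1) (push e2)).

Definition elayer k := EO Omod (EV 12) (EC k).

(** The input holds [n] and [m] at addresses 0 and 1, then the arcs; so [d] is 2 for the source of
    an arc and 3 for its target. *)
Definition eend k d := EL (EO Oadd (EC d) (EO Omul (EC 2) (EO Odiv (EV 12) (EC k)))).

Definition egood k :=
  EO Oeq (EO Oadd (eviol k (elayer k) (eend k 2))
    (eviol k (EO Omod (EO Oadd (elayer k) (EC 1)) (EC k)) (eend k 3))) (EC 0).

Definition esource k := EO Oadd (EO Omul (elayer k) (EV 2)) (eend k 2).

(** The language has no conditional: the 0/1 value of [egood] selects between the two targets. *)
Definition etarget k :=
  EO Oadd
    (EO Omul (egood k)
      (EO Oadd (EO Omul (EO Oadd (elayer k) (EC 1)) (EV 2)) (eend k 3)))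
    (EO Omul (EO Osub (EC 1) (egood k))
      (EO Oadd (EO Omul (EC k.+1) (EV 2)) (EV 12))).

(** The previous simulation has left its values in these variables, whereas a run must start with
    zero registers. *)
Definition reset M : cmd := seqs [seq Asg (16 + r) (EC 0) | r <- iota 0 M].

Definition write_instance k : seq cmd :=
  [:: push (EV 5); push (EV 6);
      push_loop 4 (EV 12) (EV 4);
      push_loop 3 (esource k) (etarget k);
      push (EV 2);
      push_loop 2 (EV 12) (EO Oadd (EO Omul (EC k) (EV 2)) (EV 12))].

(** Memory is cut into blocks of length [S], held in variable 10. Block 0 contains the input and
    block 1 the renaming table, so colouring [x] gets block [x + 2]. The last assignment is a
    disjunction with the answers so far. *)
Definition try_colouring k M P : cmd :=
  seqs [:: Asg 14 (EO Omul (EO Oadd (EV 13) (EC 2)) (EV 10)); Asg 15 (EC 0);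
    seqs (write_instance k); reset M; Sim P 14 9 16;
    Asg 0 (EO Olt (EC 0) (EO Oadd (EV 0) (EO Olt (EC 0) (EV 16))))].

Definition elow := EO Olt (EV 7) (EO Oadd (EV 5) (EC 1)).

(** The logarithm is found by doubling variable 7 as long as it is at most [nz.+1]; variable 8 grows
    by 2 at each doubling. The loop has a fixed number [nz.+1] of rounds, at least [B], and idles
    once the guard [elow] fails. Variable 10 is large enough for the input, the table, an instance
    and the whole simulated memory. *)
Definition setup k c : cmd := seqs
  [:: Asg 1 (EL (EC 1));
      Asg 2 (EO Oadd (EV 1) (EV 1));
      Asg 3 (EO Omul (EC k) (EV 1));
      Asg 4 (EO Oadd (EO Omul (EC k.+1) (EV 2)) (EV 3));
      Asg 5 (EO Oadd (EV 4) (EC 1));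
      Asg 6 (EO Oadd (EV 4) (EV 3));
      Asg 7 (EC 1);
      Asg 8 (EC 0);
      For 12 5 (Seq (Asg 8 (EO Oadd (EV 8) (EO Omul (EC 2) elow)))
                    (Asg 7 (EO Oadd (EV 7) (EO Omul (EV 7) elow))));
      Asg 9 (epow 7 c);
      Asg 10 (EO Oadd (EO Oadd (EO Oadd (EO Oadd (EV 9) (EL (EC 0)))
               (EO Oadd (EV 6) (EV 6))) (EO Oadd (EV 2) (EV 2))) (EC 10));
      Asg 11 (epow 8 (k * k))].

Definition eword := EL (EO Oadd (EC 2) (EV 12)).

(* After the two loops, the input word at position [p] has been replaced by the
   last position where the same vertex occurs. *)
Definition rename : cmd := seqs
  [:: For 12 2 (Store (EO Oadd (EV 10) eword) (EV 12));
      For 12 2 (Store (EO Oadd (EC 2) (EV 12)) (EL (EO Oadd (EV 10) eword)))].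

Definition detector k c M P : cmd :=
  Seq (setup k c) (Seq rename (For 13 11 (try_colouring k M P))).

(** * Further rules of the logic, and the environment of constants *)

Lemma triple_param w (P P' : vstate) c T :
  (forall v0 g0, P v0 g0 -> triple w (fun v g => v = v0 /\ g = g0) c P' T) ->
  triple w P c P' T.
Proof. by move=> H Q off v g f HQ R HP; exact: (H v g HP _ _ _ _ _ HQ R). Qed.

Lemma triple_exists w (A : Type) (P : A -> vstate) (P' : vstate) c T :
  (forall a, triple w (P a) c P' T) ->
  triple w (fun v g => exists a, P a v g) c P' T.
Proof. by move=> H Q off v g f HQ R [a HP]; exact: (H a _ _ _ _ _ HQ R). Qed.

Lemma triple_asg' w (P P' : vstate) r e :
  (forall v g, (forall r, v r < 2 ^ w) -> (forall a, g a < 2 ^ w) -> P v g ->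
     P' (upd v r (eval_expr w v g e)) g) ->
  triple w P (Asg r e) P' (csize (Asg r e)).
Proof.
move=> H; apply: triple_bounded.
apply: triple_conseq (@triple_asg w P' r e) _ _ (leqnn _) => // v g [HP Hv Hg].
exact: H.
Qed.

Lemma triple_store' w (P P' : vstate) e1 e2 :
  (forall v g, (forall r, v r < 2 ^ w) -> (forall a, g a < 2 ^ w) -> P v g ->
     P' v (upd g (eval_expr w v g e1) (eval_expr w v g e2))) ->
  triple w P (Store e1 e2) P' (csize (Store e1 e2)).
Proof.
move=> H; apply: triple_bounded.
apply: triple_conseq (@triple_store w P' e1 e2) _ _ (leqnn _) => // v g [HP Hv Hg].
exact: H.
Qed.

Lemma triple_seqs_cons w (P1 P2 P3 : vstate) c s T1 T2 :
  triple w P1 c P2 T1 -> triple w P2 (seqs s) P3 T2 ->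
  triple w P1 (seqs (c :: s)) P3 (T1 + T2).
Proof. exact: triple_seq. Qed.

Lemma csize_seqs_cons c s : csize (seqs (c :: s)) = csize c + csize (seqs s).
Proof. by []. Qed.

Lemma csize_seqs_nil : csize (seqs [::]) = 0.
Proof. by []. Qed.

Lemma csize_For r l c : csize (For r l c) = csize c + 7.
Proof. by []. Qed.

Lemma csize_Seq c1 c2 : csize (Seq c1 c2) = csize c1 + csize c2.
Proof. by []. Qed.

Lemma triple_seqs_nil w (P : vstate) : triple w P (seqs [::]) P 0.
Proof. exact: triple_skip. Qed.


(** Index 0 is exempt because variable 0 is the answer, which changes during the run. *)
Definition Env (l : seq nat) (v : nat -> nat) : Prop :=
  forall r, 0 < r -> r < size l -> v r = nth 0 l r.

Lemma Env_upd l v r a : size l <= r \/ r = 0 -> Env l v -> Env l (upd v r a).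
Proof.
by move=> Hr H r' H0 Hl; rewrite /upd /=; case: eqP => [E|_]; [lia | exact: H].
Qed.

Lemma Env_rcons l v a : 0 < size l -> v (size l) = a -> Env l v ->
  Env (rcons l a) v.
Proof.
move=> l0 Ha H r r0; rewrite size_rcons ltnS nth_rcons leq_eqVlt.
case/orP => [/eqP ->|Hr]; first by rewrite ltnn eqxx.
by rewrite Hr; apply: H.
Qed.

Lemma triple_const w l (P : vstate) r e a : 0 < size l -> r = size l ->
  (forall v g x, P v g -> P (upd v r x) g) ->
  (forall v g, (forall r, v r < 2 ^ w) -> Env l v -> P v g ->
     eval_expr w v g e = a) ->
  triple w (fun v g => Env l v /\ P v g) (Asg r e)
    (fun v g => Env (rcons l a) v /\ P v g) (csize (Asg r e)).
Proof.
move=> l0 -> HP He; apply: triple_asg' => v g Hv Hg [H1 H2].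
rewrite (He v g) //; split; last exact: HP.
apply: Env_rcons => //; first by rewrite /upd /= eqxx.
by apply: Env_upd => //; left.
Qed.

(** * Correctness and running time of the detector *)

Section Detector.
Variables (w k c M : nat) (P : program).
Variables (n m n2 km nz mp B A wd S X : nat).
(** The sizes are variables tied by equations, so that arithmetic can treat them as atoms. [HW] lets
    all [X + 2] blocks be addressed, with one block to spare. *)
Hypotheses (k_gt0 : 0 < k) (En2 : n2 = m + m) (Ekm : km = k * m)
  (Enz : nz = k.+1 * n2 + km) (Emp : mp = nz + km)
  (EB : B = (trunc_log 2 nz.+1).+1) (EA : A = 2 ^ B) (Ewd : wd = A ^ c)
  (ES : S = wd + n + (mp + mp) + (n2 + n2) + 10) (EX : X = (2 * B) ^ (k * k))
  (HW : (X + 3) * S < 2 ^ w) (Hk : 4 * (k * k) + k + 10 < 2 ^ w).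

Definition consts := [:: 0; m; n2; km; nz; nz.+1; mp; A; 2 * B; wd; S; X].

Let B_gt0 : 0 < B. Proof. by rewrite EB. Qed.

Let X_gt0 : 0 < X.
Proof. by rewrite EX expn_gt0; apply/orP; left; lia. Qed.

Let SX_lt : S + X < 2 ^ w.
Proof. by apply: leq_ltn_trans HW; nia. Qed.

Let A_bounds : nz.+1 < A /\ A <= 2 * nz.+1.
Proof.
have /andP[H1 H2] := trunc_log_bounds (ltnSn 1) (ltn0Sn nz).
by rewrite EA EB; split=> //; rewrite expnS leq_mul2l.
Qed.

Lemma B_le_nz1 : B <= nz.+1.
Proof.
have /andP[H1 _] := trunc_log_bounds (ltnSn 1) (ltn0Sn nz).
by rewrite EB; apply: leq_trans H1; apply: ltn_expl.
Qed.

Lemma B2_leX : 2 * B <= X.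
Proof. by rewrite EX -[leqLHS]expn1 leq_pexp2l ?muln_gt0 ?k_gt0 //; lia. Qed.

(** The bound charges the code size of the whole phase to each round of its loop. This is crude, but
    the code size does not depend on the graph. The later phases are bounded likewise. *)
Lemma setup_triple (g0 : nat -> nat) : g0 0 = n -> g0 1 = m ->
  triple w (fun v g => v 0 = 0 /\ g = g0) (setup k c)
    (fun v g => Env consts v /\ (v 0 = 0 /\ g = g0))
    (csize (setup k c) + nz.+1 * (csize (setup k c) + 6) + 3).
Proof.
move=> g00 g01.
have w1 : 1 < 2 ^ w by lia.
pose Q (v g : nat -> nat) := v 0 = 0 /\ g = g0.
have HQ r v g x : 0 < r -> Q v g -> Q (upd v r x) g.
  by move=> r0 [H0 ->]; split=> //; rewrite /upd /=; case: eqP => // E; lia.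
set T1 := csize (setup k c).
have [Al Au] := A_bounds; have BX := B2_leX.
have E1 := @triple_const w [:: 0] Q 1 (EL (EC 1)) m isT erefl
  (fun v g x => HQ 1 v g x isT).
have E2 := @triple_const w [:: 0; m] Q 2 (EO Oadd (EV 1) (EV 1)) n2 isT erefl
  (fun v g x => HQ 2 v g x isT).
have E3 := @triple_const w [:: 0; m; n2] Q 3 (EO Omul (EC k) (EV 1)) km isT erefl
  (fun v g x => HQ 3 v g x isT).
have E4 := @triple_const w [:: 0; m; n2; km] Q 4
  (EO Oadd (EO Omul (EC k.+1) (EV 2)) (EV 3)) nz isT erefl
  (fun v g x => HQ 4 v g x isT).
have E5 := @triple_const w [:: 0; m; n2; km; nz] Q 5
  (EO Oadd (EV 4) (EC 1)) nz.+1 isT erefl (fun v g x => HQ 5 v g x isT).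
have E6 := @triple_const w [:: 0; m; n2; km; nz; nz.+1] Q 6
  (EO Oadd (EV 4) (EV 3)) mp isT erefl (fun v g x => HQ 6 v g x isT).
pose l6 := [:: 0; m; n2; km; nz; nz.+1; mp].
have E7 := @triple_const w l6 Q 7 (EC 1) 1 isT erefl (fun v g x => HQ 7 v g x isT).
have E8 := @triple_const w (rcons l6 1) Q 8 (EC 0) 0 isT erefl
  (fun v g x => HQ 8 v g x isT).
have E9 := @triple_const w (rcons (rcons l6 A) (2 * B)) Q 9 (epow 7 c) wd isT erefl
  (fun v g x => HQ 9 v g x isT).
have E10 := @triple_const w (rcons (rcons (rcons l6 A) (2 * B)) wd) Q 10
  (EO Oadd (EO Oadd (EO Oadd (EO Oadd (EV 9) (EL (EC 0)))
     (EO Oadd (EV 6) (EV 6))) (EO Oadd (EV 2) (EV 2))) (EC 10))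
  S isT erefl (fun v g x => HQ 10 v g x isT).
have E11 := @triple_const w (rcons (rcons (rcons (rcons l6 A) (2 * B)) wd) S) Q 11
  (epow 8 (k * k)) X isT erefl (fun v g x => HQ 11 v g x isT).
(* After [i] rounds the doubling has taken place [minn i B] times. *)
pose I i v g := [/\ Env l6 v, v 7 = 2 ^ minn i B, v 8 = 2 * minn i B & Q v g].
pose body := Seq (Asg 8 (EO Oadd (EV 8) (EO Omul (EC 2) elow)))
                    (Asg 7 (EO Oadd (EV 7) (EO Omul (EV 7) elow))).
have Hlow i v g : v 5 = nz.+1 -> v 7 = 2 ^ minn i B ->
    eval_expr w v g elow = (i < B).
  move=> v5 v7; rewrite (@ev_lt w v g _ _ (2 ^ minn i B) nz.+2) //.
    have /andP[H1 H2] := trunc_log_bounds (ltnSn 1) (ltn0Sn nz).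
    congr nat_of_bool; rewrite ltnS; case: (ltnP i B) => Hi.
      by apply: leq_trans H1; rewrite leq_pexp2l //; lia.
    by apply/negbTE; rewrite -ltnNge -EA.
  by rewrite -[nz.+2]addn1; apply: ev_add => //; [apply: ev_c | lia].
have L : triple w (fun v g => I 0 (upd v 12 0) g /\ v 5 = nz.+1)
    (For 12 5 body) (fun v g => I nz.+1 v g /\ v 5 = nz.+1)
    (nz.+1 * (csize body + 6) + 3).
  apply: (@triple_for w I) => // i Hi.
  have pw : 2 ^ minn i B <= A by rewrite EA leq_pexp2l // geq_minr.
  apply: (@triple_seq w _ (fun v g => [/\ Env l6 v, v 7 = 2 ^ minn i B,
      v 8 = 2 * minn i.+1 B, Q v g & v 12 = i])).
    apply: triple_asg' => v g _ _ [[He v7 v8 Hq] v12 v5].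
    split; [by apply: Env_upd => //; left | exact: v7 | | exact: HQ | exact: v12].
    rewrite (@ev_add w v g _ _ (2 * minn i B) (2 * (i < B))) //.
    - by rewrite /upd /=; case: (ltnP i B); lia.
    - apply: ev_mul; [by apply: ev_c; lia|exact: Hlow|].
      by case: (i < B); lia.
    - by case: (i < B); lia.
  apply: triple_asg' => v g _ _ [He v7 v8 Hq v12].
  have v5 : v 5 = nz.+1 := He 5 isT isT.
  split; [ | exact: v12 | exact: v5].
  split; [ | | exact: v8 | exact/HQ/HQ].
  - by apply: Env_upd; [left|apply: Env_upd; [left|]].
  rewrite (@ev_add w v g _ _ (2 ^ minn i B) (2 ^ minn i B * (i < B))) //.
  - rewrite /upd /=; case: (ltnP i B) => HiB.
      rewrite muln1 addnn -mul2n -expnS; congr (2 ^ _); lia.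
    by rewrite muln0 addn0; congr (2 ^ _); lia.
  - by apply: ev_mul => //; [exact: Hlow | case: (i < B); lia].
  - by case: (i < B); lia.
have Ipre v g : Env (rcons (rcons l6 1) 0) v /\ Q v g ->
    I 0 (upd v 12 0) g /\ v 5 = nz.+1.
  move=> [He Hq]; split; last exact: (He 5 isT isT).
  split; rewrite ?min0n; [ | exact: (He 7 isT isT) | exact: (He 8 isT isT) | exact: HQ].
  by apply: Env_upd; [left | move=> r r0 Hr; rewrite (He r) ?nth_rcons ?size_rcons //=;
     move: r0 Hr; do 7 (case: r => // r)].
have Ipost v g : I nz.+1 v g /\ v 5 = nz.+1 ->
    Env (rcons (rcons l6 A) (2 * B)) v /\ Q v g.
  rewrite /I (minn_idPr B_le_nz1) -EA => -[[He v7 v8 Hq] _]; split=> //.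
  by apply: Env_rcons => //; apply: Env_rcons.
have E89 := triple_conseq L Ipre Ipost (leqnn _).
have Xk : A ^ c <= S by rewrite -Ewd; lia.
apply: triple_conseq.
- apply: triple_seqs_cons (E1 _) _ => [v g _ _ [_ ->]|].
    by apply: ev_m g01; apply: ev_c.
  apply: triple_seqs_cons (E2 _) _ => [v g _ H _|].
    by rewrite En2; apply: ev_add; [exact: (H 1 isT isT)|exact: (H 1 isT isT)|lia].
  apply: triple_seqs_cons (E3 _) _ => [v g _ H _|].
    rewrite Ekm; by apply: ev_mul; [apply: ev_c; lia|exact: (H 1 isT isT)|lia].
  apply: triple_seqs_cons (E4 _) _ => [v g _ H _|].
    rewrite Enz; apply: ev_add; [|exact: (H 3 isT isT)|lia].
    by apply: ev_mul; [apply: ev_c; lia|exact: (H 2 isT isT)|lia].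
  apply: triple_seqs_cons (E5 _) _ => [v g _ H _|].
    rewrite -[nz.+1]addn1.
    by apply: ev_add; [exact: (H 4 isT isT)|apply: ev_c; lia|lia].
  apply: triple_seqs_cons (E6 _) _ => [v g _ H _|].
    by rewrite Emp; apply: ev_add; [exact: (H 4 isT isT)|exact: (H 3 isT isT)|lia].
  apply: triple_seqs_cons (E7 _) _ => [v g _ H _|]; first by apply: ev_c; lia.
  apply: triple_seqs_cons (E8 _) _ => [v g _ H _|]; first by apply: ev_c; lia.
  apply: triple_seqs_cons E89 _.
  apply: triple_seqs_cons (E9 _) _ => [v g _ H _|].
    by rewrite Ewd; apply: ev_pow; [exact: (H 7 isT isT)|lia|lia|lia].
  apply: triple_seqs_cons (E10 _) _ => [v g _ H [_ Eg]|].
    rewrite ES; apply: ev_add; [|by apply: ev_c; lia|lia].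
    apply: ev_add; [|by apply: ev_add; [exact: (H 2 isT isT)|exact: (H 2 isT isT)|lia]|lia].
    apply: ev_add; [|by apply: ev_add; [exact: (H 6 isT isT)|exact: (H 6 isT isT)|lia]|lia].
    apply: ev_add; [exact: (H 9 isT isT)| |lia].
    by apply: ev_m; [by apply: ev_c; lia | rewrite Eg].
  apply: triple_seqs_cons (E11 _) _ => [v g _ H _|].
    by rewrite EX; apply: ev_pow; [exact: (H 8 isT isT)|lia|lia|lia].
  exact: triple_seqs_nil.
- by move=> v g HP; split=> // -[].
- by move=> v g HP.
rewrite /T1 /setup !csize_seqs_cons csize_For csize_seqs_nil -/body.
repeat match goal with |- context [csize ?x] => generalize (csize x); intro end.
set T := (X in _ <= X + _ + 3).
match goal with |- context [nz.+1 * (?b + 6) + 3 + _] =>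
  have : nz.+1 * (b + 6) <= nz.+1 * (T + 6) by rewrite leq_mul2l /T; lia
end.
by rewrite /T; lia.
Qed.
Let wd_gt0 : 0 < wd.
Proof. by rewrite Ewd EA -expnM pow2_gt0. Qed.

Variable ends : nat -> nat.
Hypothesis ends_lt : forall p, p < n2 -> ends p < n.

(** The new name of a vertex is a position where it occurs, so [ends] inverts [tab] there and [tab]
    is injective on endpoints of arcs. *)
Definition tab_ok (tab : nat -> nat) : Prop :=
  forall p, p < n2 -> tab (ends p) < n2 /\ ends (tab (ends p)) = ends p.

Lemma rename_triple (g0 : nat -> nat) :
  (forall p, p < n2 -> g0 (2 + p) = ends p) ->
  (forall a, S <= a -> g0 a = 0) ->
  triple w (fun v g => Env consts v /\ (v 0 = 0 /\ g = g0)) rename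
    (fun v g => exists tab, [/\ tab_ok tab, Env consts v, v 0 = 0,
       forall p, p < n2 -> g (2 + p) = tab (ends p) &
       forall a, S + S <= a -> g a = 0])
    (2 * (n2 * (csize rename + 6) + 3)).
Proof.
move=> Hg0 Hz0.
have n2S : n2 + n2 + n + 10 <= S by lia.
pose b1 := Store (EO Oadd (EV 10) eword) (EV 12).
pose b2 := Store (EO Oadd (EC 2) (EV 12)) (EL (EO Oadd (EV 10) eword)).
(* Overwriting the table entry of a vertex with a later position of the same vertex preserves this
   invariant. *)
pose I1 i v g := [/\ Env consts v, v 0 = 0, forall p, p < n2 -> g (2 + p) = ends p,
  forall p, p < i -> g (S + ends p) < n2 /\ ends (g (S + ends p)) = ends p &
  forall a, S + S <= a -> g a = 0].
have L1 : triple w (fun v g => I1 0 (upd v 12 0) g /\ v 2 = n2) (For 12 2 b1)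
    (fun v g => I1 n2 v g /\ v 2 = n2) (n2 * (csize b1 + 6) + 3).
  apply: (@triple_for w I1) => // i Hi.
  apply: triple_store' => v g _ _ [[H1 H2 H3 H4 H5] v12 v2].
  have Eei := ends_lt Hi.
  rewrite (@ev_add w v g (EV 10) eword S (ends i)); last lia; last 2 first.
  - exact: (H1 10 isT isT).
  - apply: (@ev_m w v g _ (2 + i)); last exact: H3.
    by apply: ev_add => //; [apply: ev_c; lia|lia].
  rewrite [eval_expr _ _ _ (EV 12)]v12; split=> //; split=> //.
  - by apply: Env_upd => //; left.
  - by move=> p Hp; rewrite /upd /= H3 //; case: eqP => // E; lia.
  - move=> p Hp; rewrite /upd /= eqn_add2l; case: eqP => [->|Np] //.
    by apply: H4; move: Hp; rewrite ltnS leq_eqVlt => /orP[/eqP E|//]; rewrite E in Np.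
  - by move=> a Ha; rewrite /upd /= H5 //; case: eqP => // E; lia.
(* The renaming is done in place: positions below [i] hold new names, the others still hold old
   ones. *)
pose I2 tab i v g := [/\ Env consts v, v 0 = 0,
  forall p, p < n2 -> g (2 + p) = if p < i then tab (ends p) else ends p,
  forall p, p < n2 -> g (S + ends p) = tab (ends p) &
  forall a, S + S <= a -> g a = 0].
have L2 tab : tab_ok tab ->
    triple w (fun v g => I2 tab 0 (upd v 12 0) g /\ v 2 = n2) (For 12 2 b2)
    (fun v g => I2 tab n2 v g /\ v 2 = n2) (n2 * (csize b2 + 6) + 3).
  move=> Htab; apply: (@triple_for w (I2 tab)) => // i Hi.
  apply: triple_store' => v g _ _ [[H1 H2 H3 H4 H5] v12 v2].
  have Eei := ends_lt Hi.
  rewrite (@ev_add w v g (EC 2) (EV 12) 2 i) //; [|by apply: ev_c; lia|lia].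
  have -> : eval_expr w v g (EL (EO Oadd (EV 10) eword)) = tab (ends i).
    apply: (@ev_m w v g _ (S + ends i)); last exact: H4.
    apply: ev_add; [exact: (H1 10 isT isT)| |lia].
    apply: (@ev_m w v g _ (2 + i)); last by rewrite H3 // ltnn.
    by apply: ev_add => //; [apply: ev_c; lia|lia].
  split=> //; split=> //.
  - by apply: Env_upd => //; left.
  - move=> p Hp; rewrite /upd /= H3 // eqn_add2l ltnS [p <= i]leq_eqVlt.
    by case: eqP => [->|].
  - by move=> p Hp; rewrite /upd /= H4 //; case: eqP => // E; lia.
  - by move=> a Ha; rewrite /upd /= H5 //; case: eqP => // E; lia.
apply: triple_conseq.
- apply: triple_seqs_cons L1 _.
  apply: (@triple_seqs_cons _ _ (fun v g => exists tab, [/\ tab_ok tab,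
       Env consts v, v 0 = 0, forall p, p < n2 -> g (2 + p) = tab (ends p) &
       forall a, S + S <= a -> g a = 0])); last exact: triple_seqs_nil.
  apply: (@triple_conseq w (fun v g => exists tab, tab_ok tab /\
      (I2 tab 0 (upd v 12 0) g /\ v 2 = n2)) _
    (fun v g => exists tab, [/\ tab_ok tab, Env consts v, v 0 = 0,
       forall p, p < n2 -> g (2 + p) = tab (ends p) &
       forall a, S + S <= a -> g a = 0])); [|  | by [] | exact: leqnn].
    apply: triple_exists => tab.
    apply: (@triple_assume _ (tab_ok tab)) => [Htab|v g []//].
    apply: triple_conseq (L2 tab Htab) _ _ (leqnn _) => [v g []//|v g].
    move=> [[H1 H2 H3 H4 H5] _]; exists tab; split=> // p Hp.
    by rewrite H3 // Hp.
  (* The renaming is the content of the table, constrained only at endpoints of arcs. *)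
  move=> v g [[H1 H2 H3 H4 H5] v2]; exists (fun z => g (S + z)).
  split; first by move=> p Hp; apply: H4.
  split=> //; split=> //.
  by apply: Env_upd => //; left.
- move=> v g [H1 [H2 ->]]; split; last exact: (H1 2 isT isT).
  split=> //; first by apply: Env_upd => //; left.
  by move=> a Ha; apply: Hz0; lia.
- by [].
rewrite /rename -/b1 -/b2 !csize_seqs_cons !csize_For csize_seqs_nil.
move: (csize b1) (csize b2) => s1 s2.
have H1 : n2 * (s1 + 6) <= n2 * (s1 + 7 + (s2 + 7 + 0) + 6) by rewrite leq_mul2l; lia.
have H2 : n2 * (s2 + 6) <= n2 * (s1 + 7 + (s2 + 7 + 0) + 6) by rewrite leq_mul2l; lia.
by lia.
Qed.

(** As [nth] defaults to 0, one clause describes both the written part of the block and its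
    remaining zeros, as [init] demands. *)
Definition Fill (base x a0 : nat) (tab : nat -> nat) (l : seq nat) : vstate :=
  fun v g => [/\ Env consts v,
    [/\ v 13 = x, v 14 = base, v 15 = size l & v 0 = a0],
    forall p, p < n2 -> g (2 + p) = tab (ends p),
    forall a, a < S -> g (base + a) = nth 0 l a %% wd &
    forall a, base + S <= a -> g a = 0].

Lemma Fill_upd base x a0 tab l v g r y : Fill base x a0 tab l v g ->
  12 <= r -> r != 13 -> r != 14 -> r != 15 -> Fill base x a0 tab l (upd v r y) g.
Proof.
case=> H1 [H2 H3 H4 H5] H6 H7 H8 r12 r13 r14 r15.
split=> //; first by apply: Env_upd => //; left.
by split; rewrite /upd /=; case: eqP => // E; lia.
Qed.

Section Fill.
Variables (base x a0 : nat) (tab : nat -> nat).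
Hypothesis base_ge : S <= base.
Hypothesis base_lt : base + S < 2 ^ w.

Notation F := (Fill base x a0 tab).

(** [R] transports what is known about the loop counter, on which the pushed value may depend. *)
Lemma push_triple (R : nat -> Prop) l e a : size l < S ->
  (forall v g, F l v g -> R (v 12) -> eval_expr w v g e = a) ->
  triple w (fun v g => F l v g /\ R (v 12)) (push e)
    (fun v g => F (rcons l a) v g /\ R (v 12)) (csize (push e)).
Proof.
move=> Hl He.
apply: (@triple_seq w _ (fun v g => [/\ R (v 12), Env consts v,
    [/\ v 13 = x, v 14 = base, v 15 = size l & v 0 = a0],
    forall p, p < n2 -> g (2 + p) = tab (ends p) &
    (forall a', a' < S -> g (base + a') = nth 0 (rcons l a) a' %% wd) /\
    forall a, base + S <= a -> g a = 0])).
  apply: triple_store' => v g Hv Hg [HF HR]; have [H1 [H2 H3 H4 H5] H6 H7 H8] := HF.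
  have Ea := He v g HF HR.
  rewrite (@ev_add w v g (EV 14) (EV 15) _ _ H3 H4); last lia.
  rewrite (@ev_mod w v g e (EV 9) a wd Ea (H1 9 isT isT)); last first.
    by rewrite -Ea; apply: eval_lt.
  split=> //.
  - by move=> p Hp; rewrite /upd /= H6 //; case: eqP => // E; lia.
  split=> a' Ha'; rewrite /upd /=; last first.
    by rewrite H8 //; case: eqP => // E; lia.
  rewrite eqn_add2l nth_rcons; case: eqP => [->|/eqP N]; first by rewrite ltnn.
  by rewrite H7 //; case: ltnP => // H; rewrite nth_default.
apply: triple_asg' => v g Hv Hg [HR H1 [H2 H3 H4 H5] H6 [H7 H8]].
split=> //; split=> //; first by apply: Env_upd => //; left.
split=> //; rewrite size_rcons /upd /= -[(size l).+1]addn1.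
by rewrite -[RHS](@ev_add w v g (EV 15) (EC 1) _ _ H4) //; [apply: ev_c; lia|lia].
Qed.

Lemma push_loop_triple l lim N e1 e2 (f : nat -> nat * nat) :
  0 < lim -> lim < 12 -> nth 0 consts lim = N -> size l + N.*2 <= S ->
  (forall q v g l', q < N -> F l' v g -> v 12 = q ->
     eval_expr w v g e1 = (f q).1 /\ eval_expr w v g e2 = (f q).2) ->
  triple w (F l) (push_loop lim e1 e2)
    (F (l ++ flatten [seq [:: a.1; a.2] | a <- [seq f q | q <- iota 0 N]]))
    (N * (csize (push_loop lim e1 e2) + 6) + 3).
Proof.
move=> lim0 lim12 EN Hl He.
pose G i := l ++ flatten [seq [:: a.1; a.2] | a <- [seq f q | q <- iota 0 i]].
have sG i : size (G i) = size l + i.*2.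
  by rewrite size_cat size_flatten2 // size_map size_iota.
have GS i : G i.+1 = rcons (rcons (G i) (f i).1) (f i).2.
  rewrite /G -addn1 iotaD !map_cat flatten_cat /= add0n.
  by rewrite !rcons_cat -!cats1 -!catA.
pose I i v g := F (G i) v g.
have HF l' v g y : F l' v g -> F l' (upd v 12 y) g.
  by case=> H1 H2 H3 H4 H5; split=> //; apply: Env_upd => //; left.
have Hlim l' v g : F l' v g -> v lim = N by case=> H1 _ _ _ _; rewrite H1.
apply: triple_conseq.
- apply: (@triple_for w I 12 lim N
    (Seq (push e1) (push e2)) (csize (push e1) + csize (push e2))).
    by rewrite neq_ltn lim12 orbT.
  move=> i Hi.
  apply: (@triple_conseq w (fun v g => F (G i) v g /\ v 12 = i) _
     (fun v g => F (G i.+1) v g /\ v 12 = i) _ _ _ _ _ _ _ (leqnn _)).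
  + rewrite GS; apply: triple_seq.
      apply: (@push_triple (fun y => y = i) (G i) e1 (f i).1); first by rewrite sG; lia.
      by move=> v g H1 H2; case: (He i v g _ Hi H1 H2).
    apply: (@push_triple (fun y => y = i) _ e2 (f i).2); first by rewrite size_rcons sG; lia.
    by move=> v g H1 H2; case: (He i v g _ Hi H1 H2).
  + by move=> v g [].
  + by move=> v g [H1 H2]; split=> //; [exact: HF | exact: Hlim H1].
- move=> v g HFl; split; last exact: Hlim HFl.
  by apply: HF; rewrite /G /= cats0.
- by move=> v g [].
rewrite csize_For csize_Seq.
by rewrite leq_add2r leq_mul //; lia.
Qed.

Definition usrc j := tab (ends j.*2).
Definition utgt j := tab (ends j.*2.+1).

Hypothesis tabP : tab_ok tab.
Hypothesis x_lt : x < X.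

Let arc_eval q v g l : q < km -> F l v g -> v 12 = q ->
  eval_expr w v g (esource k) = (arcf k n2 (2 * B) x usrc utgt q).1 /\
  eval_expr w v g (etarget k) = (arcf k n2 (2 * B) x usrc utgt q).2.
Proof.
move=> Hq [H1 [H2 H3 H4 H5] H6 H7 H8] v12.
have v2 : v 2 = n2 := H1 2 isT isT.
have v8 : v 8 = 2 * B := H1 8 isT isT.
have Hj : q %/ k < m by rewrite ltn_divLR // mulnC -Ekm.
have Hi : q %% k < k by rewrite ltn_mod.
have Hi' : (q %% k).+1 %% k < k by rewrite ltn_mod.
have bX : 2 * B <= X by rewrite EX -[leqLHS]expn1 leq_pexp2l ?muln_gt0 ?k_gt0 //; lia.
have kn : k.+1 * n2 + km <= S by lia.
have jS : 2 * (q %/ k) + 3 < S by lia.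
have Ei : eval_expr w v g (elayer k) = q %% k.
  by apply: ev_mod => //; [apply: ev_c; lia | lia].
have Ej : eval_expr w v g (EO Odiv (EV 12) (EC k)) = q %/ k.
  by apply: ev_div => //; [apply: ev_c; lia | lia].
have Eu : eval_expr w v g (eend k 2) = usrc (q %/ k).
  apply: (@ev_m w v g _ (2 + 2 * (q %/ k))).
    apply: ev_add; [apply: ev_c; lia| |lia].
    by apply: ev_mul => //; [apply: ev_c; lia | lia].
  by rewrite H6 ?mul2n //; lia.
have Ev : eval_expr w v g (eend k 3) = utgt (q %/ k).
  apply: (@ev_m w v g _ (3 + 2 * (q %/ k))).
    apply: ev_add; [apply: ev_c; lia| |lia].
    by apply: ev_mul => //; [apply: ev_c; lia | lia].
  by rewrite -[3 + _]/(2 + (1 + 2 * (q %/ k))) H6 ?mul2n //; lia.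
have uL : usrc (q %/ k) < n2 by case: (tabP (p := (q %/ k).*2)) => //; lia.
have vL : utgt (q %/ k) < n2 by case: (tabP (p := (q %/ k).*2.+1)) => //; lia.
have n2S : n2 + X < 2 ^ w by lia.
have Eg : eval_expr w v g (egood k) =
    (viol k (2 * B) x (q %% k) (usrc (q %/ k)) +
     viol k (2 * B) x ((q %% k).+1 %% k) (utgt (q %/ k)) == 0).
  have V1 := viol_le k (2 * B) x (q %% k) (usrc (q %/ k)).
  have V2 := viol_le k (2 * B) x ((q %% k).+1 %% k) (utgt (q %/ k)).
  apply: ev_eq; [|by apply: ev_c; lia|lia].
  apply: ev_add; last lia.
    by apply: (ev_viol _ v8 H2 Ei Eu) => //; rewrite -?EX; lia.
  apply: (ev_viol _ v8 H2 _ Ev) => //; rewrite -?EX; try lia.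
  apply: ev_mod; [|by apply: ev_c; lia|lia].
  by rewrite -[(q %% k).+1]addn1; apply: ev_add => //; [apply: ev_c; lia | lia].
have in2 : (q %% k).+1 * n2 <= k * n2 by rewrite leq_mul2r Hi orbT.
have kn2 : k.+1 * n2 = n2 + k * n2 by rewrite mulSn.
have in2' : (q %% k).+1 * n2 = n2 + q %% k * n2 by rewrite mulSn.
rewrite /arcf; split; rewrite [RHS]/=.
  by apply: ev_add => //; [apply: ev_mul => //; lia | lia].
rewrite (@ev_add w v g _ _
  ((viol k (2 * B) x (q %% k) (usrc (q %/ k)) +
     viol k (2 * B) x ((q %% k).+1 %% k) (utgt (q %/ k)) == 0) *
     ((q %% k).+1 * n2 + utgt (q %/ k)))
  ((1 - (viol k (2 * B) x (q %% k) (usrc (q %/ k)) +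
     viol k (2 * B) x ((q %% k).+1 %% k) (utgt (q %/ k)) == 0)) *
    (k.+1 * n2 + q))).
- by case: (_ == 0) => /=; lia.
- apply: ev_mul => //; last by case: (_ == 0) => /=; lia.
  apply: ev_add => //; last lia.
  apply: ev_mul => //; last lia.
  by rewrite -[(q %% k).+1]addn1; apply: ev_add => //; [apply: ev_c; lia | lia].
- apply: ev_mul; last by case: (_ == 0) => /=; lia.
    by apply: ev_sub => //; [apply: ev_c; lia | case: (_ == 0) | lia].
  apply: ev_add => //; last lia.
  apply: ev_mul => //; last lia.
  by apply: ev_c; lia.
- by case: (_ == 0) => /=; lia.
Qed.

Definition instance_code : seq nat :=
  nz.+1 :: encode_list (larcs k n2 (2 * B) x m usrc utgt) ++
           encode_list (lpairs k n2).

Let nzE : nzv k n2 m = nz. Proof. by rewrite /nzv Enz Ekm. Qed.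

Lemma write_instance_triple : triple w (F [::]) (seqs (write_instance k))
  (F instance_code)
  (csize (seqs (write_instance k)) +
   (nz + km + n2) * (csize (seqs (write_instance k)) + 6) + 9).
Proof.
have eq_list : instance_code = ((([:: nz.+1; mp] ++
     flatten [seq [:: a.1; a.2] | a <- [seq (q, nz) | q <- iota 0 nz]]) ++
     flatten [seq [:: a.1; a.2] |
       a <- [seq arcf k n2 (2 * B) x usrc utgt q | q <- iota 0 km]]) ++ [:: n2]) ++
     flatten [seq [:: a.1; a.2] | a <- [seq (q, k * n2 + q) | q <- iota 0 n2]].
  rewrite /instance_code /encode_list size_larcs nzE -Ekm -Emp.
  rewrite /larcs /lpairs !size_map size_iota nzE -Ekm map_cat flatten_cat.
  by rewrite /= -!catA.
have sz1 N (f : nat -> nat * nat) :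
    size (flatten [seq [:: a.1; a.2] | a <- [seq f q | q <- iota 0 N]]) = N.*2.
  by rewrite size_flatten2 // size_map size_iota.
have push1 l e a : size l < S ->
    (forall v g, F l v g -> eval_expr w v g e = a) ->
    triple w (F l) (push e) (F (rcons l a)) (csize (push e)).
  move=> Hl He; apply: triple_conseq (@push_triple (fun=> True) l e a Hl _) _ _ _ => //.
  - by move=> v g H _; exact: He.
  - by move=> v g [].
have knS : k * n2 + n2 <= S by rewrite addnC -mulSn; lia.
apply: triple_conseq.
- apply: triple_seqs_cons.
    apply: (@push1 [::] _ nz.+1) => /=; first lia.
    by move=> v g [H1 _ _ _ _]; exact: (H1 5 isT isT).
  apply: triple_seqs_cons.
    apply: (@push1 _ _ mp) => /=; first lia.
    by move=> v g [H1 _ _ _ _]; exact: (H1 6 isT isT).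
  apply: triple_seqs_cons.
    apply: (@push_loop_triple _ 4 nz _ _ (fun q => (q, nz))) => //=; first lia.
    by move=> q v g l Hq [H1 _ _ _ _] v12; split; [|exact: (H1 4 isT isT)].
  apply: triple_seqs_cons.
    apply: (@push_loop_triple _ 3 km _ _ (arcf k n2 (2 * B) x usrc utgt)) => //.
      by rewrite size_cat sz1 /=; lia.
  apply: triple_seqs_cons.
    apply: (@push1 _ _ n2) => /=; first by rewrite !size_cat !sz1 /=; lia.
    by move=> v g [H1 _ _ _ _]; exact: (H1 2 isT isT).
  apply: triple_seqs_cons.
    apply: (@push_loop_triple _ 2 n2 _ _ (fun q => (q, k * n2 + q))) => //.
      by rewrite size_rcons !size_cat !sz1 /=; lia.
    move=> q v g l Hq [H1 _ _ _ _] v12; split=> //.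
    apply: ev_add => //; last lia.
    apply: ev_mul; [by apply: ev_c; lia|exact: (H1 2 isT isT)|lia].
  exact: triple_seqs_nil.
- by [].
- by move=> v g; rewrite eq_list cats1.
rewrite /write_instance !csize_seqs_cons csize_seqs_nil.
repeat match goal with |- context [csize ?y] => generalize (csize y); intro end.
set T := (X in _ <= X + _ * (X + 6) + 9).
have le a b : a <= T -> b * (a + 6) <= b * (T + 6) by move=> H; rewrite leq_mul2l; lia.
rewrite !mulnDl.
repeat match goal with |- context [?b * (?a + 6)] =>
  lazymatch a with T => fail | _ =>
  have := @le a b ltac:(rewrite /T; lia); generalize (b * (a + 6)) end; intros end.
by rewrite /T in H H0 H1 *; lia.
Qed.

End Fill.

Hypotheses (M_gt0 : 0 < M) (PM : all (instr_lt M) P).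

Lemma reset_triple base x a0 tab l :
  triple w (Fill base x a0 tab l) (reset M)
    (fun v g => Fill base x a0 tab l v g /\ forall r, r < M -> v (16 + r) = 0)
    (csize (reset M)).
Proof.
suff H j i : triple w
    (fun v g => Fill base x a0 tab l v g /\ forall r, r < j -> v (16 + r) = 0)
    (seqs [seq Asg (16 + r) (EC 0) | r <- iota j i])
    (fun v g => Fill base x a0 tab l v g /\ forall r, r < j + i -> v (16 + r) = 0)
    (csize (seqs [seq Asg (16 + r) (EC 0) | r <- iota j i])).
  by apply: triple_conseq (H 0 M) _ _ (leqnn _) => [v g|v g []].
elim: i j => [|i IH] j; first by rewrite addn0; exact: triple_seqs_nil.
apply: triple_seqs_cons; last by rewrite addnS -addSn; exact: IH.
apply: triple_asg' => v g _ _ [H1 H2]; split.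
  by apply: (Fill_upd _ H1); lia.
move=> r Hr; rewrite /upd /= eqn_add2l mod0n; case: eqP => // /eqP N.
by apply: H2; lia.
Qed.

(** The approximation algorithm enters only through this interface, with one time bound [tm] for all
    renamings and colourings. *)
Variables (tm : nat) (ans : (nat -> nat) -> nat -> bool).
Hypothesis ans_run : forall tab x, tab_ok tab -> x < X -> exists t,
  [/\ t <= tm, halted P (run (c * B) P (instance_code x tab) t) &
      (regs (run (c * B) P (instance_code x tab) t) 0 != 0) = ans tab x].

Definition Loop (tab : nat -> nat) (x : nat) : vstate := fun v g =>
  [/\ Env consts v, v 0 = nat_of_bool (has (ans tab) (iota 0 x)),
      forall p, p < n2 -> g (2 + p) = tab (ends p) &
      forall a, (x + 2) * S <= a -> g a = 0].

Lemma try_colouring_triple tab x : tab_ok tab -> x < X ->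
  triple w (fun v g => Loop tab x v g /\ v 13 = x) (try_colouring k M P)
    (fun v g => Loop tab x.+1 v g /\ v 13 = x)
    (csize (try_colouring k M P) +
     (nz + km + n2) * (csize (try_colouring k M P) + 6) + 9 + tm.*2.+2).
Proof.
move=> tabP x_lt; have [t [Ht Hh Hans]] := ans_run tabP x_lt.
pose base := (x + 2) * S; pose a0 := nat_of_bool (has (ans tab) (iota 0 x)).
have baseS : base + S = (x.+1 + 2) * S by rewrite /base -mulSnr.
have base_lt : base + S < 2 ^ w.
  by apply: leq_ltn_trans HW; rewrite baseS leq_mul2r; apply/orP; right; lia.
have base_ge2 : S + S <= base by rewrite /base mulnDl; lia.
have base_ge : S <= base by lia.
have x2_lt : x + 2 < 2 ^ w.
  have : x + 2 <= base by rewrite leq_pmulr //; lia.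
  by lia.
(* The exponent [c * B] is the word size prescribed for an instance with [nz.+1] vertices. *)
have wdE : wd = 2 ^ (c * B) by rewrite Ewd EA -expnM mulnC.
have wdS : wd <= S by lia.
set s := run (c * B) P (instance_code x tab) t in Hh Hans.
apply: (@triple_conseq w (fun v g => Loop tab x v g /\ v 13 = x) _
  (fun v g => Loop tab x.+1 v g /\ v 13 = x)).
- apply: (@triple_seqs_cons w _ (fun v g => Loop tab x v g /\
    (v 13 = x /\ v 14 = base))).
    apply: triple_asg' => v g _ _ [[H1 H2 H3 H4] v13].
    have -> : eval_expr w v g (EO Omul (EO Oadd (EV 13) (EC 2)) (EV 10)) = base.
      apply: ev_mul; [|exact: (H1 10 isT isT)|rewrite -/base; lia].
      by apply: ev_add => //; apply: ev_c; lia.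
    by split=> //; split=> //; apply: Env_upd => //; left.
  apply: (@triple_seqs_cons w _ (Fill base x a0 tab [::])).
    apply: triple_asg' => v g _ _ [[H1 H2 H3 H4] [v13 v14]].
    split=> //.
    + by apply: Env_upd => //; left.
    + by split=> //; rewrite /upd /= mod0n.
    + by move=> a Ha; rewrite nth_nil mod0n H4 // leq_addr.
    + by move=> a Ha; rewrite H4 //; apply: leq_trans Ha; rewrite leq_addr.
  apply: triple_seqs_cons (@write_instance_triple base x a0 tab base_ge base_lt tabP x_lt) _.
  apply: triple_seqs_cons (@reset_triple base x a0 tab (instance_code x tab)) _.
  apply: (@triple_seqs_cons w _ (fun v g => [/\ Env consts v,
      v 13 = x /\ v 0 = a0, v 16 = regs s 0,
      forall p, p < n2 -> g (2 + p) = tab (ends p) &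
      forall a, base + S <= a -> g a = 0])).
    (* The state before the simulation is frozen, because [triple_sim] describes what is unchanged
       relative to fixed reference values. *)
    apply: triple_param => v0 g0 [[H1 [H2 H3 H4 H5] H6 H7 H8] H9].
    apply: triple_conseq (@triple_sim w (c * B) P 14 9 16 M base v0 g0
      (instance_code x tab) t s M_gt0 PM isT isT H3 _ _ erefl Hh) _ _ _.
    + by rewrite -wdE; exact: (H1 9 isT isT).
    + by rewrite -wdE; lia.
    + move=> v g [-> ->]; split=> // a; rewrite -wdE => Ha; apply: H7.
      by lia.
    + move=> v g [G1 G2 G3]; split=> //.
      * by move=> r r0 Hr; rewrite G1; [exact: H1 | exact: leq_trans Hr _].
      * by rewrite !G1.
      * by move=> p Hp; rewrite G3 ?H6 // -wdE; lia.
      * by move=> a Ha; rewrite G3 ?H8 // -wdE; lia.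
    + exact: leqnn.
  apply: triple_seqs_cons; last exact: triple_seqs_nil.
  apply: triple_asg' => v g _ _ [H1 [H2 H3] H4 H5 H6].
  have w1 : 1 < 2 ^ w by lia.
  have -> : eval_expr w v g (EO Olt (EC 0) (EO Oadd (EV 0) (EO Olt (EC 0) (EV 16))))
      = (0 < a0 + (0 < v 16)).
    apply: ev_lt => //; first by apply: ev_c; lia.
    apply: ev_add => //; last by rewrite /a0; case: has; case: (0 < v 16); lia.
    by apply: ev_lt => //; apply: ev_c; lia.
  split; last exact: H2.
  split; [by apply: Env_upd => //; right| |exact: H5|by rewrite -baseS; exact: H6].
  rewrite -[x.+1]addn1 iotaD has_cat /upd /= H4 [0 < regs s 0]lt0n Hans.
  rewrite orbF add0n /a0.
  by case: has; case: ans.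
- by [].
- by [].
rewrite /try_colouring !csize_seqs_cons csize_seqs_nil.
repeat match goal with |- context [csize ?y] => generalize (csize y); intro end.
set T := (X in _ <= X + _ * (X + 6) + 9 + _).
have le a b : a <= T -> b * (a + 6) <= b * (T + 6) by move=> H; rewrite leq_mul2l; lia.
match goal with |- context [?b * (?a + 6)] =>
  lazymatch a with T => fail | _ =>
  have := @le a b ltac:(rewrite /T; lia); generalize (b * (a + 6)) end; intros end.
by rewrite /T in H *; lia.
Qed.

Lemma detector_triple (g0 : nat -> nat) : g0 0 = n -> g0 1 = m ->
  (forall p, p < n2 -> g0 (2 + p) = ends p) ->
  (forall a, S <= a -> g0 a = 0) ->
  triple w (fun v g => v 0 = 0 /\ g = g0) (detector k c M P)
    (fun v g => exists2 tab, tab_ok tab &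
       v 0 = nat_of_bool (has (ans tab) (iota 0 X)))
    (csize (setup k c) + nz.+1 * (csize (setup k c) + 6) + 3 +
     (2 * (n2 * (csize rename + 6) + 3) +
      (X * (csize (try_colouring k M P) +
     (nz + km + n2) * (csize (try_colouring k M P) + 6) + 9 + tm.*2.+2 + 6) + 3))).
Proof.
move=> g00 g01 Hg0 Hz0.
apply: triple_seq (setup_triple g00 g01) _.
apply: triple_seq (rename_triple Hg0 Hz0) _.
apply: triple_exists => tab.
apply: (@triple_assume _ (tab_ok tab)) => [tabP|v g []//].
apply: triple_conseq (@triple_for w (Loop tab) 13 11 X (try_colouring k M P)
  _ isT _) _ _ (leqnn _).
- move=> i Hi; apply: triple_conseq (try_colouring_triple tabP Hi) _ _ (leqnn _).
    by move=> v g [].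
  move=> v g [[H1 H2 H3 H4] v13]; split=> //; last exact: (H1 11 isT isT).
  by split=> //; apply: Env_upd => //; left.
- move=> v g [_ H1 H2 H3 H4]; split; last exact: (H1 11 isT isT).
  split=> //; first by apply: Env_upd => //; left.
  by move=> a Ha; apply: H4; lia.
- by move=> v g [[H1 H2 H3 H4] _]; exists tab.
Qed.

End Detector.

(** * Size and time bounds *)

(** All quantities are polynomial in [n], because distinct arcs give [m <= n * n]; so a constant
    multiple of the logarithm of [n] is enough bits. [E1] is the exponent for [S], [E2] the one for
    [X], and [E3] covers the constant. *)
Lemma word_bound (k c : nat) : exists2 c', 0 < c' & forall n m nz mp B A wd S X,
  m <= n * n -> nz = k.+1 * (m + m) + k * m -> mp = nz + k * m ->
  B = (trunc_log 2 nz.+1).+1 -> A = 2 ^ B -> wd = A ^ c ->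
  S = wd + n + (mp + mp) + ((m + m) + (m + m)) + 10 ->
  X = (2 * B) ^ (k * k) ->
  (X + 3) * S < 2 ^ word_size c' n /\ 4 * (k * k) + k + 10 < 2 ^ word_size c' n.
Proof.
pose D := 4 * k + 4; pose E1 := (D + 3) * c + (D + 2); pose E2 := (D + 4) * (k * k).
pose E3 := 4 * (k * k) + k + 10.
(* The 7 is 4 for the factor 16 in the bound on [S], 2 for the factor 4 in the bound on [X + 3], and
   1 for strictness. *)
exists (E1 + E2 + E3 + 7) => [|n m nz mp B A wd S X Hm Enz Emp EB EA Ewd ES EX].
  by lia.
pose N := 2 ^ (trunc_log 2 n).+1.
have -> : 2 ^ word_size (E1 + E2 + E3 + 7) n = N ^ (E1 + E2 + E3 + 7).
  by rewrite /word_size mulnC expnM.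
have nN : n < N by apply: trunc_log_ltn.
have N2 : 2 <= N by rewrite /N -[leqLHS]expn1 leq_pexp2l.
have N0 : 0 < N by lia.
have leE d x y : x <= y -> x ^ d <= y ^ d.
  by case: d => [|d] H; rewrite ?expn0 ?leq_exp2r.
have pow2N d : 2 ^ d <= N ^ d by exact: leE.
have monoN a b : a <= b -> N ^ a <= N ^ b by move=> H; rewrite leq_pexp2l.
have ltN d : d < N ^ d by apply: leq_trans (pow2N d); apply: ltn_expl.
have mN : m <= N ^ 2.
  by apply: leq_trans Hm _; rewrite -mulnn leq_mul // ltnW.
have N2_gt0 : 0 < N ^ 2 by rewrite expn_gt0 N0.
have DN : D * N ^ 2 <= N ^ (D + 2).
  by rewrite expnD leq_mul2r; apply/orP; right; apply: ltnW.
have kmN : k * m <= k * N ^ 2 by rewrite leq_mul2l mN orbT.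
have DE : D * N ^ 2 = 4 * (k * N ^ 2) + 4 * N ^ 2 by rewrite /D mulnDl mulnA.
have nzE : nz = 2 * m + 3 * (k * m) by rewrite Enz mulSn; lia.
have nz1N : nz.+1 <= N ^ (D + 2) by apply: leq_trans DN; rewrite DE nzE; lia.
have mpN : mp <= N ^ (D + 2) by apply: leq_trans DN; rewrite DE Emp nzE; lia.
have n2N : m + m <= N ^ (D + 2) by apply: leq_trans DN; rewrite DE; lia.
have /andP[T1 T2] := trunc_log_bounds (ltnSn 1) (ltn0Sn nz).
have A_le : A <= 2 * nz.+1 by rewrite EA EB expnS leq_mul2l.
have AN : A <= N ^ (D + 3).
  apply: leq_trans A_le _; rewrite addnS expnS; apply: leq_mul => //.
have BA : B <= A by rewrite EA ltnW // ltn_expl.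
have B2N : 2 * B <= N ^ (D + 4).
  by rewrite addnS expnS; apply: leq_mul => //; apply: leq_trans BA AN.
have XN : X <= N ^ E2 by rewrite EX /E2 [leqRHS]expnM; apply: leE.
have wdN : wd <= N ^ ((D + 3) * c) by rewrite Ewd expnM; apply: leE.
have wdN1 : wd <= N ^ E1 by apply: leq_trans wdN (monoN _ _ _); rewrite leq_addr.
have D1 : N ^ (D + 2) <= N ^ E1 by apply: monoN; rewrite leq_addl.
have nE1 : n <= N ^ E1.
  by apply: leq_trans (ltnW nN) _; rewrite -[leqLHS]expn1 monoN // /E1; lia.
have E1_gt0 : 0 < N ^ E1 by rewrite expn_gt0 N0.
have E2_gt0 : 0 < N ^ E2 by rewrite expn_gt0 N0.
have S16 : S <= N ^ (E1 + 4).
  rewrite expnD mulnC; apply: (@leq_trans (16 * N ^ E1)); first lia.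
  by rewrite leq_mul2r; apply/orP; right; apply: leq_trans (pow2N 4).
have X4 : X + 3 <= N ^ (E2 + 2).
  rewrite expnD mulnC; apply: (@leq_trans (4 * N ^ E2)); first lia.
  by rewrite leq_mul2r; apply/orP; right; apply: leq_trans (pow2N 2).
split; last by apply: leq_trans (ltN E3) (monoN _ _ _); lia.
apply: (@leq_ltn_trans (N ^ (E2 + 2 + (E1 + 4)))).
  by rewrite expnD; apply: leq_mul.
by rewrite ltn_exp2l //; lia.
Qed.

Section Polylog.
Local Open Scope ring_scope.

(** The inequality [1 + y <= expR y] at [y = t * d * ln 2] gives [1 + t * d * ln 2 <= (2 ^ t) ^ d],
    and [2 ^ t <= N]. *)
Lemma trunc_log_powR (R : realType) (d : R) : 0 < d ->
  exists2 C : R, 0 <= C & forall N, (0 < N)%N ->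
    (trunc_log 2 N).+1%:R <= C * N%:R `^ d.
Proof.
move=> d0; have l2 : 0 < d * ln 2 :> R by rewrite mulr_gt0 // ln_gt0 // ltr1n.
exists (1 + (d * ln 2)^-1) => [|N N0].
  by rewrite addr_ge0 // invr_ge0 ltW.
set t := trunc_log 2 N; have /andP[H1 _] := trunc_log_bounds (ltnSn 1) N0.
have key : 1 + t%:R * (d * ln 2) <= N%:R `^ d :> R.
  apply: (@le_trans _ _ ((2 ^ t)%N%:R `^ d)); last first.
    by rewrite ge0_ler_powR ?nnegrE ?ler_nat // ltW.
  rewrite natrX -powR_mulrn // -powRrM /powR pnatr_eq0 /=.
  apply: le_trans (expR_ge1Dx _) _.
  by rewrite ler_expR mulrA.
have H : t%:R <= (d * ln 2)^-1 * N%:R `^ d :> R.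
  rewrite ler_pdivlMl // mulrC; apply: le_trans key.
  by rewrite lerDr.
have H' : 1 <= N%:R `^ d :> R.
  by apply: le_trans key; rewrite lerDl mulr_ge0 // ltW.
by rewrite -addn1 natrD mulrDl mul1r addrC lerD.
Qed.

(** The logarithm is bounded with exponent [d / (j + 1)] and the bound raised to the power [j]; the
    successor avoids a division by zero at [j = 0]. *)
Lemma polylog_powR (R : realType) (d : R) j : 0 < d ->
  exists2 C : R, 0 <= C & forall N, (0 < N)%N ->
    ((2 * (trunc_log 2 N).+1) ^ j)%N%:R <= C * N%:R `^ d.
Proof.
move=> d0; have d1 : 0 < d / j.+1%:R by rewrite divr_gt0.
have [C C0 HC] := trunc_log_powR d1.
exists ((2 * C) ^+ j) => [|N N0]; first by rewrite exprn_ge0 // mulr_ge0.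
rewrite natrX natrM; have N1 : 1 <= N%:R :> R by rewrite ler1n.
apply: (@le_trans _ _ ((2 * (C * N%:R `^ (d / j.+1%:R))) ^+ j)).
  by rewrite lerXn2r ?nnegrE ?mulr_ge0 ?powR_ge0 // ler_wpM2l // HC.
rewrite mulrA exprMn ler_wpM2l ?exprn_ge0 ?mulr_ge0 //.
rewrite -powR_mulrn ?powR_ge0 // -powRrM ler_powR //.
by rewrite mulrAC ler_pdivrMr // ler_wpM2l ?ler_nat // ltW.
Qed.

Lemma layered_size (k m nz : nat) : (0 < m)%N ->
  nz = (k.+1 * (m + m) + k * m)%N ->
  [/\ (nz.+1 <= (4 * k + 4) * m)%N, (nz + k * m <= (4 * k + 4) * m)%N &
      (nz + k * m + (m + m) <= (4 * k + 4) * m)%N].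
Proof.
move=> m0; rewrite mulSn mulnDl -mulnA mulnDr => ->.
by move: (k * m)%N => km; split; lia.
Qed.

End Polylog.

(* [X] runs that each take time [O(m + tm)], after a preprocessing linear in
   [m]. *)
Lemma time_bound (k a b d : nat) : exists K0, forall m nz X tm,
  (0 < m) -> (0 < X) -> nz = (k.+1 * (m + m) + k * m) ->
  (a + nz.+1 * (a + 6) + 3 + (2 * ((m + m) * (b + 6) + 3) +
     (X * (d + (nz + k * m + (m + m)) * (d + 6) + 9 + tm.*2.+2 + 6) + 3))
   <= K0 * (X * (m + tm))).
Proof.
pose D := (4 * k + 4).
exists (a + D * (a + 6) + 3 + 4 * (b + 6) + 6 + d + D * (d + 6) + 9 + 8 + 3 + 2).
move=> m nz X tm m0 X0 Enz.
have [h1 _ h2] := layered_size m0 Enz.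
set Y := (X * (m + tm)).
have mY : (m <= Y) by rewrite (leq_trans (leq_addr tm m)) // leq_pmull.
have Y0 : (0 < Y) by apply: leq_trans mY.
have XY : (X <= Y) by rewrite leq_pmulr // addn_gt0 m0.
have XmY : (X * m <= Y) by rewrite leq_mul2l leq_addr orbT.
have XtY : (X * tm <= Y) by rewrite leq_mul2l leq_addl orbT.
have g1 : (nz.+1 * (a + 6) <= D * (a + 6) * Y).
  by rewrite mulnAC; apply: leq_mul => //; apply: leq_trans h1 _; rewrite leq_mul2l mY orbT.
have g2 : ((m + m) * (b + 6) <= 2 * (b + 6) * Y).
  by rewrite mulnAC; apply: leq_mul => //; rewrite mul2n -addnn leq_add.
have g3 : (X * ((nz + k * m + (m + m)) * (d + 6)) <= D * (d + 6) * Y).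
  rewrite mulnA [leqRHS]mulnAC; apply: leq_mul => //.
  apply: (@leq_trans (X * (D * m))); first by rewrite leq_mul2l h2 orbT.
  by rewrite mulnCA leq_mul2l XmY orbT.
have g4 : (X * d <= d * Y) by rewrite mulnC leq_mul2l XY orbT.
have pY z : (z <= z * Y) by rewrite leq_pmulr.
have := pY a; rewrite !mulnDl !mulnDr -/Y => pa.
move: g1 g2 g3 g4 pa; rewrite !mulnDl ?mulnDr; lia.
Qed.

(** * The arc list as read from the input *)

Definition endpoint (G : digraph) (p : nat) : nat := nth 0 (encode_digraph G) (2 + p).

Lemma endpointE (G : digraph) (a0 : 'I_(nverts G) * 'I_(nverts G)) j :
  j < narcs G ->
  endpoint G j.*2 = val (nth a0 (arcs G) j).1 /\
  endpoint G j.*2.+1 = val (nth a0 (arcs G) j).2.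
Proof.
move=> Hj; rewrite /endpoint /encode_digraph /encode_pairs /=.
by split; [rewrite -[j.*2]addn0|rewrite -addn1]; rewrite (@nth_flatten2 _ _ 0 a0).
Qed.

Lemma endpoint_lt (G : digraph) p : p < narcs G + narcs G -> endpoint G p < nverts G.
Proof.
move=> Hp; have Hj : p./2 < narcs G by lia.
case E: (arcs G) => [|a0 s]; first by move: Hj; rewrite /narcs E.
have [E1 E2] := endpointE a0 Hj.
rewrite -[p]odd_double_half; case: (odd p); rewrite ?add0n ?add1n ?E1 ?E2; exact: ltn_ord.
Qed.

Lemma endpoint_default (G : digraph) a : narcs G + narcs G + 2 <= a ->
  nth 0 (encode_digraph G) a = 0.
Proof.
move=> Ha; rewrite nth_default //= size_flatten2 //.
by rewrite -/(narcs G) -addnn; lia.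
Qed.

Lemma narcs_le (G : digraph) : narcs G <= nverts G * nverts G.
Proof.
rewrite /narcs -(card_uniqP (arcs_uniq G)) (leq_trans (max_card _)) //.
by rewrite card_prod !card_ord.
Qed.

Lemma tab_ok_arcs (G : digraph) (m : nat) tab : m = narcs G ->
  tab_ok (m + m) (endpoint G) tab ->
  (forall a, a \in arcs G -> tab (val a.1) < m + m /\ tab (val a.2) < m + m) /\
  (forall a c (y z : 'I_(nverts G)), a \in arcs G -> c \in arcs G ->
     (y == a.1) || (y == a.2) -> (z == c.1) || (z == c.2) ->
     tab (val y) = tab (val z) -> y = z).
Proof.
move=> -> tabP.
have arcE a : a \in arcs G -> exists j, [/\ j < narcs G,
    endpoint G j.*2 = val a.1 & endpoint G j.*2.+1 = val a.2].
  move=> Ha; exists (index a (arcs G)); have H : index a (arcs G) < narcs G.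
    by rewrite /narcs index_mem.
  by have [-> ->] := endpointE a H; rewrite nth_index.
have arcP a (y : 'I_(nverts G)) : a \in arcs G -> (y == a.1) || (y == a.2) ->
    exists2 p, p < narcs G + narcs G & endpoint G p = val y.
  move=> /arcE[j [Hj E1 E2]] /orP[] /eqP ->.
    by exists j.*2 => //; lia.
  by exists j.*2.+1 => //; lia.
split=> [a Ha|a c y z Ha Hc Hy Hz].
  have [p Hp <-] := arcP a a.1 Ha (introT orP (or_introl (eqxx _))).
  have [q Hq <-] := arcP a a.2 Ha (introT orP (or_intror (eqxx _))).
  by have [? _] := tabP p Hp; have [? _] := tabP q Hq.
have [p Hp Ep] := arcP a y Ha Hy; have [q Hq Eq] := arcP c z Hc Hz.
rewrite -Ep -Eq => E; apply: val_inj; rewrite /= -Ep -Eq.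
by have [_ <-] := tabP p Hp; have [_ <-] := tabP q Hq; rewrite E.
Qed.

(** * From the approximation algorithm to the detector *)

Section Reduction.
Variables (R : realType) (K : nat) (alpha : nat -> nat -> R) (P : program).
Variables (c : nat) (C e : R).
Hypothesis K_gt0 : 0 < K.
Hypothesis approx : approximates_min_dist K alpha P c C e.

Definition walk_exists (k n2 b m : nat) (ends tab : nat -> nat) (x : nat) : bool :=
  `[< exists v p, [/\ v < n2,
        path (adjl (larcs k n2 b x m (usrc ends tab) (utgt ends tab))) v p &
        last v p = k * n2 + v] >].

Lemma approx_run (k n2 km nz mp m B x : nat) (ends tab : nat -> nat) (G0 : digraph) :
  0 < k -> m = narcs G0 -> n2 = m + m -> km = k * m -> nz = k.+1 * n2 + km ->
  mp = nz + km -> B = (trunc_log 2 nz.+1).+1 -> ends = endpoint G0 ->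
  tab_ok n2 ends tab ->
  exists t, [/\ 0 < m -> (t%:R <= C * mp%:R `^ e)%R,
    halted P (run (c * B) P (instance_code k m n2 nz B ends x tab) t) &
    (regs (run (c * B) P (instance_code k m n2 nz B ends x tab) t) 0 != 0)
      = walk_exists k n2 (2 * B) m ends tab x].
Proof.
move=> k0 Em En2 Ekm Enz Emp EB Eends tabP.
have nzE : nzv k n2 m = nz by rewrite /nzv Enz Ekm.
pose us := usrc ends tab; pose vs := utgt ends tab.
have usL j : j < m -> us j < n2 by move=> Hj; case: (tabP j.*2) => //; lia.
have vsL j : j < m -> vs j < n2 by move=> Hj; case: (tabP j.*2.+1) => //; lia.
(* Equal new names mean equal old vertices by [tab_ok], and no arc is listed twice. *)
have inj j j' : j < m -> j' < m -> us j = us j' -> vs j = vs j' -> j = j'.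
  rewrite Em => Hj Hj' Eu Ev.
  case E: (arcs G0) => [|a0 s]; first by rewrite /narcs E in Hj.
  have [D1 D2] := endpointE a0 Hj; have [D1' D2'] := endpointE a0 Hj'.
  have [|_ T1] := tabP j.*2; first lia.
  have [|_ T1'] := tabP j'.*2; first lia.
  have [|_ T2] := tabP j.*2.+1; first lia.
  have [|_ T2'] := tabP j'.*2.+1; first lia.
  apply/eqP; rewrite -(nth_uniq a0 Hj Hj' (arcs_uniq G0)); apply/eqP.
  rewrite /us /vs /usrc /utgt in Eu Ev.
  move: T1 T2; rewrite Eu Ev T1' T2' Eends D1 D2 D1' D2'.
  move=> /val_inj X1 /val_inj X2.
  by rewrite [LHS]surjective_pairing [RHS]surjective_pairing X1 X2.
have bnd := larcs_bounds (2 * B) x k0 usL vsL; rewrite nzE in bnd.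
have [G [EnG EmG EG HG]] :=
  digraph_of_list R bnd (uniq_larcs (2 * B) x k0 usL vsL inj).
have [|pairs [Sp Ep Hp]] := HG (lpairs k n2).
  apply/allP => a /mapP[v]; rewrite mem_iota /= add0n => Hv ->.
  have E : k.+1 * n2 = n2 + k * n2 by rewrite mulSn.
  by rewrite /=; lia.
have [||t] := approx (G := G) (pairs := pairs).
(* The sink alone receives [nz] arcs, for [nz.+1] vertices in total. *)
- by rewrite EnG EmG size_larcs nzE ltnS leq_addr.
- rewrite Sp size_map size_iota EnG; apply: (@leq_trans nz.+1).
    by rewrite Enz mulSn; lia.
  by rewrite leq_pmull.
move=> [Hh Hout Htime]; exists t.
have Einp : encode_digraph G ++ encode_pairs pairs =
    instance_code k m n2 nz B ends x tab.
  by rewrite EG Ep.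
have Ew : word_size c (nverts G) = c * B by rewrite EnG EB.
rewrite Einp Ew in Hh Hout Htime; split=> //.
  rewrite EmG size_larcs nzE -Ekm -Emp in Htime => m0; apply: Htime.
  by rewrite Emp Ekm addn_gt0 muln_gt0 k0 m0 orbT.
have Hfin := output_finite (min_dist_ge0 R pairs) Hout.
apply/idP/asboolP.
  move/Hfin/Hp => [a [p [/mapP[v]]]]; rewrite mem_iota /= add0n => Hv -> Hpath Hl.
  by exists v, p.
move=> [v [p [Hv Hpath Hl]]]; apply/Hfin/Hp; exists (v, k * n2 + v), p; split=> //.
by apply/mapP; exists v; rewrite // mem_iota add0n.
Qed.


(** The runs need a common time bound. If [m] is positive, the bound in terms of [mp] is independent
    of the colouring, and its integer part serves. If [m] is 0, no running time is promised, but all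
    instances coincide and the time of a single run will do. *)
Lemma approx_run_bound (k n2 km nz mp m B : nat) (ends : nat -> nat) (G0 : digraph) :
  0 < k -> m = narcs G0 -> n2 = m + m -> km = k * m -> nz = k.+1 * n2 + km ->
  mp = nz + km -> B = (trunc_log 2 nz.+1).+1 -> ends = endpoint G0 ->
  exists tm, [/\ 0 < m -> (tm%:R <= `|C| * mp%:R `^ e)%R &
    forall tab x, tab_ok n2 ends tab -> exists t, [/\ t <= tm,
      halted P (run (c * B) P (instance_code k m n2 nz B ends x tab) t) &
      (regs (run (c * B) P (instance_code k m n2 nz B ends x tab) t) 0 != 0)
        = walk_exists k n2 (2 * B) m ends tab x]].
Proof.
move=> k0 Em En2 Ekm Enz Emp EB Eends.
have H x tab := @approx_run k n2 km nz mp m B x ends tab G0 k0 Em En2 Ekm Enz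
  Emp EB Eends.
have [m0|m0] := posnP m.
  have n20 : n2 = 0 by rewrite En2 m0.
  have [|t [_ Hh Hr]] := H 0 id; first by move=> p; rewrite n20.
  have E0 x x' us vs us' vs' : larcs k n2 (2 * B) x m us vs = larcs k n2 (2 * B) x' m us' vs'.
    by rewrite /larcs /nzv n20 m0 !muln0.
  exists t; split; first by [].
  move=> tab x _; exists t; split=> //.
    by move: Hh; rewrite /instance_code (E0 0 x _ _ (usrc ends tab) (utgt ends tab)).
  move: Hr; rewrite /instance_code (E0 0 x _ _ (usrc ends tab) (utgt ends tab)) => ->.
  by rewrite /walk_exists (E0 0 x _ _ (usrc ends tab) (utgt ends tab)).
have Y0 : (0 <= `|C| * mp%:R `^ e)%R by rewrite mulr_ge0 ?powR_ge0.
exists (Num.truncn (`|C| * mp%:R `^ e)%R); split=> [_|]; first by rewrite truncn_le.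
move=> tab x /(H x)[t [Ht Hh Hr]]; exists t; split=> //.
rewrite truncn_ge_nat //; apply: le_trans (Ht m0) _.
by rewrite ler_wpM2r ?powR_ge0 // ler_norm.
Qed.

Lemma detector_correct (k M c' : nat) : 0 < k -> 0 < M -> all (instr_lt M) P ->
  (forall n m nz mp B A wd S X,
    m <= n * n -> nz = k.+1 * (m + m) + k * m -> mp = nz + k * m ->
    B = (trunc_log 2 nz.+1).+1 -> A = 2 ^ B -> wd = A ^ c ->
    S = wd + n + (mp + mp) + ((m + m) + (m + m)) + 10 ->
    X = (2 * B) ^ (k * k) ->
    (X + 3) * S < 2 ^ word_size c' n /\ 4 * (k * k) + k + 10 < 2 ^ word_size c' n) ->
  forall G, exists t, let Q := compile 0 (detector k c M P) in
    let s := run (word_size c' (nverts G)) Q (encode_digraph G) t in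
    [/\ halted Q s, (regs s 0 != 0) = has_kcycle k G &
    exists nz X tm, [/\ nz = k.+1 * (narcs G + narcs G) + k * narcs G,
      X = (2 * (trunc_log 2 nz.+1).+1) ^ (k * k),
      0 < narcs G -> (tm%:R <= `|C| * (nz + k * narcs G)%:R `^ e)%R &
      t <= csize (setup k c) + nz.+1 * (csize (setup k c) + 6) + 3 +
       (2 * ((narcs G + narcs G) * (csize rename + 6) + 3) +
        (X * (csize (try_colouring k M P) +
         (nz + k * narcs G + (narcs G + narcs G)) * (csize (try_colouring k M P) + 6)
         + 9 + tm.*2.+2 + 6) + 3))]].
Proof.
move=> k0 M0 PM WB G.
set w := word_size c' (nverts G); pose n := nverts G; pose m := narcs G.
pose nz := k.+1 * (m + m) + k * m; pose mp := nz + k * m.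
pose B := (trunc_log 2 nz.+1).+1; pose A := 2 ^ B; pose wd := A ^ c.
pose S := wd + n + (mp + mp) + ((m + m) + (m + m)) + 10.
pose X := (2 * B) ^ (k * k).
have [HW Hk] := WB n m nz mp B A wd S X (narcs_le G) erefl erefl erefl erefl
  erefl erefl erefl.
have [tm [Htm Hrun]] := @approx_run_bound k (m + m) (k * m) nz mp m B (endpoint G) G
  k0 erefl erefl erefl erefl erefl erefl erefl.
pose g0 a := nth 0 (encode_digraph G) a %% 2 ^ w.
have X0 : 0 < X by rewrite expn_gt0.
have SW : S < 2 ^ w by apply: leq_ltn_trans HW; rewrite leq_pmull // addnS.
have ends_lt p : p < m + m -> endpoint G p < n := @endpoint_lt G p.
have nS : n < S by rewrite /S; lia.
have mS : m < S by rewrite /S; lia.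
have g00 : g0 0 = n by rewrite /g0 modn_small //= (ltn_trans nS).
have g01 : g0 1 = m by rewrite /g0 modn_small //= (ltn_trans mS).
have g0e p : p < m + m -> g0 (2 + p) = endpoint G p.
  by move=> Hp; rewrite /g0 -/(endpoint G p) modn_small //; have := ends_lt p Hp; lia.
have g0z a : S <= a -> g0 a = 0.
  move=> Ha; rewrite /g0 endpoint_default ?mod0n //.
  by move: Ha; rewrite /S -/m; lia.
have D := detector_triple (w := w) (M := M) k0 (erefl (m + m)) (erefl (k * m)) (erefl nz)
  (erefl mp) (erefl B) (erefl A) (erefl wd) (erefl S) (erefl X) HW Hk ends_lt M0 PM
  (fun tab x Ht _ => Hrun tab x Ht) g00 g01 g0e g0z.
have R0 : represents w (fun=> 0) g0 (fun=> 0).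
  by split=> // [_|a]; rewrite ?pow2_gt0 // ltn_mod pow2_gt0.
have [t [v' [g' [f' [Ht Hs [Rf _ _] [tab tabP V0]]]]]] :=
  D (compile 0 (detector k c M P)) 0 _ _ _ (@contains_self _) R0 (conj erefl erefl).
exists t => Q s; have Es : s = State (0 + csize (detector k c M P)) f' g' by exact: Hs.
split.
- by rewrite Es /halted /fetch nth_default // size_compile.
- rewrite Es /= (Rf 0) V0 eqb0 negbK.
  have [tabL tabI] := tab_ok_arcs (erefl m) tabP.
  have n2B : m + m <= 2 ^ B.
    have /andP[_ T2] := trunc_log_bounds (ltnSn 1) (ltn0Sn nz).
    by apply: leq_trans (ltnW T2); rewrite /nz mulSn; lia.
  have usvs a0 j : j < narcs G ->
      usrc (endpoint G) tab j = tab (val (nth a0 (arcs G) j).1) /\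
      utgt (endpoint G) tab j = tab (val (nth a0 (arcs G) j).2).
    by move=> Hj; rewrite /usrc /utgt; have [-> ->] := endpointE a0 Hj.
  have HK := has_kcycle_layered k0 (ltn0Sn _ : 0 < B) n2B tabL tabI usvs.
  apply/hasP/idP => [[x]|/HK[x [v [p [Hx Hv Hp Hl]]]]].
    rewrite mem_iota add0n => /andP[_ Hx] /asboolP[v [p [Hv Hp Hl]]].
    by apply/HK; exists x, v, p.
  exists x; first by rewrite mem_iota add0n.
  by apply/asboolP; exists v, p.
by exists nz, X, tm.
Qed.

End Reduction.

Local Open Scope ring_scope.

Theorem theorem11 (R : realType) (kCH : kCycle_Hypothesis R)
    (K : nat) (hK : (0 < K)%N) (alpha : nat -> nat -> R)
    (eps : R) (heps : 0 < eps) :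
  ~ exists (P : program) (c : nat) (C : R),
      approximates_min_dist K alpha P c C (2 - eps).
Proof.
move=> [P [c [C approx]]].
(* The minimum with 1 makes [e0 = 2 - 2 * d] at least 1, so linear work also fits under [m ^ e0].
   The colourings cost a factor [m ^ d], for a total exponent of [2 - d]. *)
pose d : R := Num.min eps 1 / 2.
have d0 : 0 < d by rewrite divr_gt0 // lt_min heps ltr01.
have d_eps : d * 2 <= eps by rewrite divfK // ge_min lexx.
have d_1 : d * 2 <= 1 by rewrite divfK // ge_min lexx orbT.
have [k k0 Hk] := kCH d d0; apply: Hk.
have [M M0 PM] := instr_lt_bound P.
have [c' _ WB] := word_bound k c.
have [Cl Cl0 HCl] := polylog_powR (k * k) d0.
have [K0 HK0] := time_bound k (csize (setup k c)) (csize rename)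
  (csize (try_colouring k M P)).
pose e0 : R := 2 - d * 2.
have e0_ge1 : 1 <= e0 by rewrite /e0; lra.
pose D := (4 * k + 4)%N.
(* [CX] bounds the number of colourings and [C2] the cost per colouring, up to powers of [m];
   [D * m] bounds the size of an instance. *)
pose CX := Cl * D%:R `^ d; pose C2 := 1 + `|C| * D%:R `^ e0.
have CX0 : 0 <= CX by rewrite mulr_ge0 ?powR_ge0.
exists (compile 0 (detector k c M P)), c', (K0%:R * (CX * C2)) => G.
have [t [Hh Hr [nz [X [tm [Enz EX Htm Ht]]]]]] :=
  detector_correct hK approx k0 M0 PM WB G.
exists t; split=> // m0; set m := narcs G in m0 Enz Htm Ht *.
have X0 : (0 < X)%N by rewrite EX expn_gt0.
have [nz1 mpD _] := layered_size m0 Enz.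
have mp0 : (0 < nz + k * m)%N by rewrite addn_gt0 muln_gt0 k0 m0 orbT.
have powD (x : R) y : 0 <= x -> (y <= D * m)%N ->
    y%:R `^ x <= D%:R `^ x * m%:R `^ x.
  move=> x0 Hy; rewrite -powRM ?ler0n // -natrM.
  by rewrite ge0_ler_powR ?nnegrE ?ler_nat.
have HX : X%:R <= CX * m%:R `^ d.
  rewrite EX; apply: le_trans (HCl nz.+1 (ltn0Sn _)) _.
  by rewrite /CX -mulrA ler_wpM2l // powD // ltW.
have m1 : 1 <= m%:R :> R by rewrite ler1n.
have Hmt : m%:R + tm%:R <= C2 * m%:R `^ e0.
  rewrite /C2 mulrDl mul1r lerD //.
    by rewrite -[leLHS]powRr1 ?ler0n // ler_powR.
  apply: le_trans (Htm m0) _; rewrite -mulrA ler_wpM2l //.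
  (* The exponent [2 - eps] may be raised to [e0], as the number of arcs of an instance is at least
     1. *)
  apply: (@le_trans _ _ ((nz + k * m)%N%:R `^ e0)).
    by rewrite ler_powR ?ler1n // /e0; lra.
  by apply: powD => //; lra.
apply: (@le_trans _ _ (K0%:R * (X%:R * (m%:R + tm%:R)))).
  rewrite -natrD -!natrM ler_nat; apply: leq_trans Ht _.
  exact: HK0 m nz X tm m0 X0 Enz.
rewrite -!mulrA ler_wpM2l //.
have -> : 2 - d = d + e0 by rewrite /e0; lra.
have -> : m%:R `^ (d + e0) = m%:R `^ d * m%:R `^ e0.
  by rewrite powRD //; apply/implyP => _; rewrite pnatr_eq0 -lt0n.
apply: (@le_trans _ _ ((CX * m%:R `^ d) * (C2 * m%:R `^ e0))).
  by apply: ler_pM.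
by rewrite mulrACA /CX -!mulrA.
Qed.
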